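(* Let $(X,d,\mu,\mathcal{E},\mathcal{F})$ be a Dirichlet space satisfying the standing assumptions (A1)–(A3), (HK), (BE) stated in the context, and let $0<\delta<1$. Let $$\alpha_1^{\#}=\sup\{\alpha>0:\ \mathbf{B}^{1,\alpha}(X)\text{ contains non-constant functions}\}.$$ (i) If $\delta\le 1-\frac{\kappa}{d_W}$, then $\alpha_1^{\#}=1$. (ii) If $\delta>1-\frac{\kappa}{d_W}$, then $\alpha_1^{\#}=\frac1\delta\left(1-\frac{\kappa}{d_W}\right)$.
   Context: Setting. $(X,d,\mu)$ is a locally compact metric measure space, $\mu$ a Radon measure supported on $X$, and $(\mathcal{E},\mathcal{F})$ is a Dirichlet form on $L^2(X,\mu)$ with heat semigroup $\{P_t\}_{t>0}$ and generator $L$. Write $B(x,r)=\{y: d(x,y)<r\}$. For $\lambda>0$, $1\le p<\infty$, $KS^{\lambda,p}(X)$ is the set of $f\in L^p(X,\mu)$ with $\limsup_{r\to0^+}\int_X\int_{B(x,r)}\frac{|f(x)-f(y)|^p}{r^{\lambda p}\mu(B(x,r))}d\mu(y)d\mu(x)<\infty$. Standing assumptions. (A1) Every ball $B(x,r)$ has compact closure. (A2) There are $c_1,c_2,d_H>0$ with $c_1r^{d_H}\le\mu(B(x,r))\le c_2r^{d_H}$ for all $x\in X$, $r\ge0$. (A3) $(\mathcal{E},\mathcal{F})$ is regular and strongly local. (HK) $\{P_t\}$ has a continuous heat kernel $p_t(x,y)$ and there are $c_3,c_4,c_5,c_6\in(0,\infty)$, $d_W\in[2,\infty)$ with $c_5t^{-d_H/d_W}\exp(-c_6(d(x,y)^{d_W}/t)^{1/(d_W-1)})\le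 p_t(x,y)\le c_3t^{-d_H/d_W}\exp(-c_4(d(x,y)^{d_W}/t)^{1/(d_W-1)})$ for $\mu\times\mu$-a.e. $(x,y)$ and every $t>0$. (BE) There is $C>0$ such that $|P_tg(x)-P_tg(y)|\le C\frac{d(x,y)^\kappa}{t^{\kappa/d_W}}\|g\|_{L^\infty(X,\mu)}$ for all $t>0$, $g\in L^\infty(X,\mu)$, $x,y\in X$, where $0<\kappa<d_W$ is defined by $d_W-\kappa=\sup\{\lambda>0: KS^{\lambda,1}(X)\text{ contains non-constant functions}\}$. Subordinated semigroup. For fixed $0<\delta<1$ let $\eta^{(\delta)}_t\ge0$ be the continuous function with $\int_0^\infty\eta^{(\delta)}_t(s)e^{-s\lambda}ds=e^{-t\lambda^\delta}$ for $\lambda>0$. The semigroup with generator given by the fractional Laplacian $(-L)^\delta$ is $P^{(\delta)}_tf=\int_0^\infty\eta^{(\delta)}_t(s)P_sf\,ds$, with heat kernel $p^{(\delta)}_t(x,y)=\int_0^\infty\eta^{(\delta)}_t(s)p_s(x,y)ds$. Besov classes. For $p\ge1$, $\alpha\ge0$: $\|f\|_{p,\alpha}=\sup_{t>0}t^{-\alpha}\left(\int_X\int_X|f(x)-f(y)|^pp^{(\delta)}_t(x,y)d\mu(x)d\mu(y)\right)^{1/p}$ and $\mathbf{B}^{p,\alpha}(X)=\{f\in L^p(X,\mu):\|f\|_{p,\alpha}<\infty\}$. *)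

(* Defs.v *)
From HB Require Import structures.
From mathcomp Require Import all_boot all_order all_algebra.
From mathcomp Require Import all_classical all_reals all_analysis.

Set Implicit Arguments.
Unset Strict Implicit.
Unset Printing Implicit Defensive.

Import Order.TTheory GRing.Theory Num.Theory.
Import numFieldNormedType.Exports.

Local Open Scope classical_set_scope.
Local Open Scope ring_scope.

(* The measurable sets of a metric measure space are its Borel sets. *)
HB.mixin Record Metric_isBorel (R : numDomainType) d T
    & Metric R T & Measurable d T := {
  borel_measurableE : @measurable d T = <<s @open T >>
}.

#[short(type="borelMetricType")]
HB.structure Definition BorelMetric (R : numDomainType) d :=
  { T of Metric R T & Measurable d T & Metric_isBorel R d T }.

Section metric_measure_space.
Context (R : realType) (d : measure_display) (X : borelMetricType R d).
Implicit Types (U K A : set X) (x : X) (r : R).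

Definition radon_measure (mu : set X -> \bar R) : Prop :=
  [/\ forall K, compact K -> (mu K < +oo)%E,
      forall A, measurable A ->
        mu A = ereal_inf [set mu U | U in [set U | open U /\ A `<=` U]]
    & forall U, open U ->
        mu U = ereal_sup [set mu K | K in [set K | compact K /\ K `<=` U]] ].

Definition full_support (mu : set X -> \bar R) : Prop :=
  forall U, open U -> U !=set0 -> (0 < mu U)%E.

Definition proper_metric : Prop :=
  forall x r, compact (closure (ball x r)).

Definition ahlfors_regular (mu : set X -> \bar R) (dH : R) : Prop :=
  exists c1 c2 : R, [/\ 0 < c1, 0 < c2 &
    forall x r, 0 <= r ->
      ((c1 * r `^ dH)%:E <= mu (ball x r) <= (c2 * r `^ dH)%:E)%E].

End metric_measure_space.

(* Elements of L^p are handled through representatives f : X -> R, so operators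
   and forms on L^2 are only meaningful up to mu-a.e. equality. *)
Section dirichlet_form.
Context (R : realType) (d : measure_display) (X : borelMetricType R d).
Variable mu : {measure set X -> \bar R}.
Variables (F : set (X -> R)) (E : (X -> R) -> (X -> R) -> R).
Implicit Types f g h : X -> R.

Definition form_E1 f g : R := E f g + \int[mu]_x (f x * g x).

Definition form_cauchy (u : nat -> X -> R) : Prop :=
  forall e : R, 0 < e -> exists N : nat, forall m n : nat,
    (N <= m)%N -> (N <= n)%N -> form_E1 (u m \- u n) (u m \- u n) < e.

Definition unit_contraction f : X -> R :=
  fun x => Num.min (Num.max (f x) 0) 1.

Record dirichlet_form : Prop := {
  dom_L2 : forall f, F f -> f \in Lfun mu 2%:E ;
  dom_ae : forall f g, F f -> measurable_fun setT g -> f = g %[ae mu] -> F g ;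
  form_ae : forall f g h, F f -> F g -> F h -> f = g %[ae mu] ->
    E f h = E g h ;
  dom0 : F (cst 0) ;
  dom_linear : forall (a : R) f g, F f -> F g -> F (fun x => a * f x + g x) ;
  dom_dense : forall f (e : R), f \in Lfun mu 2%:E -> 0 < e ->
    exists2 g, F g & ('N[mu]_2%:E[EFin \o (f \- g)%R] < e%:E)%E ;
  form_sym : forall f g, F f -> F g -> E f g = E g f ;
  form_linear : forall (a : R) f g h, F f -> F g -> F h ->
    E (fun x => a * f x + g x) h = a * E f h + E g h ;
  form_ge0 : forall f, F f -> 0 <= E f f ;
  form_closed : forall u : nat -> X -> R, (forall n, F (u n)) ->
    form_cauchy u ->
    exists2 f, F f & form_E1 (u n \- f) (u n \- f) @[n --> \oo] --> (0 : R) ;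
  form_markov : forall f, F f ->
    F (unit_contraction f) /\
    E (unit_contraction f) (unit_contraction f) <= E f f
}.

Definition continuous_compactly_supported f : Prop :=
  continuous f /\ compact (closure [set x | f x != 0]).

Definition regular_form : Prop :=
  (forall f (e : R), F f -> 0 < e ->
    exists g, [/\ F g, continuous_compactly_supported g &
      form_E1 (f \- g) (f \- g) < e]) /\
  (forall f (e : R), continuous_compactly_supported f -> 0 < e ->
    exists g, [/\ F g, continuous_compactly_supported g &
      forall x, `|f x - g x| <= e]).

(* Support of the measure |f| dmu, which is invariant under changing f on a
   null set. *)
Definition ae_support f : set X :=
  [set x | forall U, open U -> U x -> ~ {ae mu, forall y, U y -> f y = 0}].

Definition strongly_local : Prop :=
  forall f g, F f -> F g -> compact (ae_support f) -> compact (ae_support g) ->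
    (exists (U : set X) (c : R), [/\ open U, ae_support f `<=` U &
      {ae mu, forall x, U x -> g x = c}]) ->
    E f g = 0.

(* Graph of the generator of the form: E(f, g) = - <L f, g> for all g in F. *)
Definition form_generator f h : Prop :=
  [/\ F f, h \in Lfun mu 2%:E &
      forall g, F g -> E f g = - \int[mu]_x (h x * g x)].

Definition semigroup_generator (P : R -> (X -> R) -> X -> R) f h : Prop :=
  [/\ f \in Lfun mu 2%:E, h \in Lfun mu 2%:E &
      'N[mu]_2%:E[EFin \o (fun x => (P t f x - f x) / t - h x)%R]%E
        @[t --> 0^'+] --> 0%E].

(* P is the strongly continuous contraction semigroup generated by the
   generator L of the form, i.e. P t = e^(tL). *)
Record heat_semigroup (P : R -> (X -> R) -> X -> R) : Prop := {
  semigroup_L2 : forall (t : R) f, 0 < t ->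
    f \in Lfun mu 2%:E -> P t f \in Lfun mu 2%:E ;
  semigroup_linear : forall (t a : R) f g, 0 < t ->
    f \in Lfun mu 2%:E -> g \in Lfun mu 2%:E ->
    P t (fun x => a * f x + g x) = (fun x => a * P t f x + P t g x) %[ae mu] ;
  semigroup_contraction : forall (t : R) f, 0 < t -> f \in Lfun mu 2%:E ->
    ('N[mu]_2%:E[EFin \o P t f] <= 'N[mu]_2%:E[EFin \o f])%E ;
  semigroupD : forall (s t : R) f, 0 < s -> 0 < t -> f \in Lfun mu 2%:E ->
    P (s + t) f = P s (P t f) %[ae mu] ;
  semigroup_cont : forall f, f \in Lfun mu 2%:E ->
    'N[mu]_2%:E[EFin \o (P t f \- f)%R]%E @[t --> 0^'+] --> 0%E ;
  semigroup_generatorE : forall f h,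
    semigroup_generator P f h <-> form_generator f h
}.

Definition continuous_heat_kernel (P : R -> (X -> R) -> X -> R)
    (p : R -> X -> X -> R) : Prop :=
  forall t : R, 0 < t ->
    continuous (fun z : X * X => p t z.1 z.2) /\
    forall f, f \in Lfun mu 2%:E ->
      {ae mu, forall x,
        ((P t f x)%:E = \int[mu]_y (p t x y * f y)%:E)%E}.

End dirichlet_form.

Section heat_kernel.
Context (R : realType) (d : measure_display) (X : borelMetricType R d).
Implicit Types (p : R -> X -> X -> R) (x y : X).

Definition sub_gaussian (dH dW c c' t : R) x y : R :=
  c * t `^ (- (dH / dW)) *
  expR (- (c' * (mdist x y `^ dW / t) `^ (dW - 1)^-1)).

Definition sub_gaussian_bounds (mu : {sigma_finite_measure set X -> \bar R})
    p (dH dW : R) : Prop :=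
  exists c3 c4 c5 c6 : R, [/\ 0 < c3, 0 < c4, 0 < c5, 0 < c6 &
    forall t : R, 0 < t ->
      {ae (mu \x mu)%E, forall z : X * X,
        sub_gaussian dH dW c5 c6 t z.1 z.2 <= p t z.1 z.2
          <= sub_gaussian dH dW c3 c4 t z.1 z.2}].

(* Through its kernel, P_t g is defined at every point, also for g bounded. *)
Definition heat_operator (mu : {measure set X -> \bar R}) p (t : R)
    (g : X -> R) (x : X) : R :=
  \int[mu]_y (p t x y * g y).

Definition weak_bakry_emery (mu : {measure set X -> \bar R}) p
    (kappa dW : R) : Prop :=
  exists2 C : R, 0 < C & forall (t : R) (g : X -> R) x y,
    0 < t -> g \in Lfun mu +oo%E ->
    (`|heat_operator mu p t g x - heat_operator mu p t g y|%:E
      <= (C * (mdist x y `^ kappa / t `^ (kappa / dW)))%:E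
         * 'N[mu]_+oo[EFin \o g])%E.

(* Density of the delta-stable subordinator; its Laplace transform determines
   it among continuous functions. *)
Definition subordinator_density (delta : R) (eta : R -> R -> R) : Prop :=
  forall t : R, 0 < t ->
    [/\ {within `]0, +oo[, continuous (eta t)},
        forall s, 0 < s -> 0 <= eta t s &
        forall lambda : R, 0 < lambda ->
          (\int[lebesgue_measure]_(s in `]0%R, +oo[)
             (eta t s * expR (- (s * lambda)))%:E
           = (expR (- (t * lambda `^ delta)))%:E)%E].

Definition subordinated_kernel (eta : R -> R -> R) p (t : R) x y : \bar R :=
  (\int[lebesgue_measure]_(s in `]0%R, +oo[) (eta t s * p s x y)%:E)%E.

End heat_kernel.

Section function_classes.
Context (R : realType) (d : measure_display) (X : borelMetricType R d).
Variable mu : {measure set X -> \bar R}.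
Implicit Types (f : X -> R) (K : R -> X -> X -> \bar R).

(* Constancy of an element of L^p: up to a null set. *)
Definition nonconstant f : Prop :=
  ~ exists c : R, f = cst c %[ae mu].

Definition korevaar_schoen (lambda q : R) : set (X -> R) :=
  [set f | f \in Lfun mu q%:E /\
    (limf_esup (fun r : R =>
       \int[mu]_x \int[mu]_(y in ball x r)
         ((`|f x - f y| `^ q / r `^ (lambda * q))%:E * (mu (ball x r))^-1))
       0^'+ < +oo)%E].

Definition korevaar_schoen_exponent (q : R) : \bar R :=
  ereal_sup [set lambda%:E | lambda in
    [set lambda : R | 0 < lambda /\
       exists2 f, korevaar_schoen lambda q f & nonconstant f]].

Definition besov_seminorm K (q alpha : R) f : \bar R :=
  (ereal_sup [set (t `^ (- alpha))%:E *
     (\int[mu]_y \int[mu]_x ((`|f x - f y| `^ q)%:E * K t x y)) `^ q^-1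
   | t in `]0%R, +oo[])%E.

Definition besov_class K (q alpha : R) : set (X -> R) :=
  [set f | f \in Lfun mu q%:E /\ (besov_seminorm K q alpha f < +oo)%E].

Definition besov_exponent K (q : R) : \bar R :=
  ereal_sup [set alpha%:E | alpha in
    [set alpha : R | 0 < alpha /\
       exists2 f, besov_class K q alpha f & nonconstant f]].

End function_classes.

(* Main.v *)
Require Import Defs.
From mathcomp Require Import all_boot all_order all_algebra finmap.
From mathcomp Require Import all_classical all_reals all_analysis.
From mathcomp Require Import measurable_realfun ring lra.

Set Implicit Arguments.
Unset Strict Implicit.
Unset Printing Implicit Defensive.

Import Order.TTheory GRing.Theory Num.Theory.
Import numFieldNormedType.Exports.
Local Open Scope classical_set_scope.
Local Open Scope ring_scope.

(** Write [Phi r] for the double integral of [`|f x - f y|] over the pairs at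
    distance less than [r] ([oscillation] below). Both function classes measure
    how fast [Phi] vanishes, and the theorem amounts to
    [alpha1 = min 1 ((dW - kappa) / (delta * dW))].

    By volume regularity, [f] in L^1 belongs to the Korevaar-Schoen class of
    exponent [lam] iff [Phi r] is [O(r `^ (dH + lam))] as [r] tends to [0], and
    [dW - kappa] is the supremum of these [lam] over nonconstant [f].

    The subordinated kernel has two bounds
    ([subordinated_kernel_ge], [subordinated_kernel_le]): a constant times
    [t * rho `^ (- (dH + delta * dW))] from below, if [mdist x y <= rho] and
    [t <= rho `^ (delta * dW)], and a constant times
    [t `^ th * mdist x y `^ (- (dH + th * delta * dW))] from above, for every
    [th] in [0, 1]. The density of the subordinator is given by its Laplace
    transform, so the sub-Gaussian factor is compared with combinations of
    exponentials, whose integrals are explicit ([profile_ge], [profile_le]).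

    The lower bound shows that if [f] has Besov exponent [al], then [Phi rho] is
    at most a constant times [t `^ (al - 1) * rho `^ (dH + delta * dW)]. Taking
    [t = rho `^ (delta * dW)] places [f] in the Korevaar-Schoen class of exponent
    [al * delta * dW], whence [al <= (dW - kappa) / (delta * dW)]; if [1 < al],
    letting [t] tend to [0] gives [Phi = 0] and [f] is constant.

    Conversely let [al < 1] and [al * delta * dW < lam], with [f] in the
    Korevaar-Schoen class of exponent [lam]. The upper bound with [th = al]
    bounds the Besov seminorm by the integral of
    [`|f x - f y| * mdist x y `^ (- (dH + al * delta * dW))]. A dyadic
    decomposition bounds it by geometric series: at small scales because of the
    decay of [Phi], at large scales because [Phi r] is at most a constant times
    [r `^ dH] for any integrable [f] ([fractional_energy_lty]). *)

(** * The sub-Gaussian profile against exponentials *)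

Section elementary_inequalities.
Context {R : realType}.
Implicit Types a b c g u x N : R.

(** This is [y <= expR y], with [y = c * x / b], raised to the power [b]. *)
Lemma powR_le_expR b c x : 0 < b -> 0 < c -> 0 <= x ->
  x `^ b <= (b / c) `^ b * expR (c * x).
Proof.
move=> b0 c0 x0.
have bc0 : 0 < b / c by rewrite divr_gt0.
have e : c * x = (c / b * x) * b by field; lra.
rewrite e expRM -powRM ?expR_ge0 ?(ltW bc0)//.
have h : x <= b / c * expR (c / b * x).
  have := @expR_ge1Dx _ (c / b * x).
  rewrite -(@ler_pM2l _ (b / c))// => H; apply: le_trans H.
  by rewrite mulrDr mulrA (_ : b / c * (c / b) = 1) ?mul1r ?mulr1 ?lerDr ?ltW//; field; lra.
apply: (ge0_ler_powR (ltW b0)) => //; rewrite nnegrE.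
by rewrite mulr_ge0 ?expR_ge0// ltW.
Qed.

(** The sub-Gaussian factor as a function of the dimensionless time
    [u = s / mdist x y `^ dW]; [profile_scale] restores the scale. *)
Definition profile a g c u : R := u `^ (- a) * expR (- (c * u `^ (- g))).

Lemma powR_inv u g : 0 <= u -> u^-1 `^ g = u `^ (- g).
Proof. by move=> u0; rewrite -(powR_inv1 u0) -powRrM mulN1r. Qed.

Lemma profileE a g c u : 0 <= u ->
  profile a g c u = u `^ (- a) * expR (- (c * u^-1 `^ g)).
Proof. by move=> u0; rewrite powR_inv. Qed.

Lemma profile_ge0 a g c u : 0 <= profile a g c u.
Proof. by rewrite mulr_ge0 ?powR_ge0 ?expR_ge0. Qed.

Lemma expRN_diff_ge u : 0 <= u -> u * expR (- u) <= 1 - expR (- u).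
Proof.
move=> u0; rewrite -(@ler_pM2r _ (expR u)) ?expR_gt0//.
rewrite -mulrA mulrBl (mulrC (expR (- u))) expRxMexpNx_1.
have := @expR_ge1Dx _ u; lra.
Qed.

(** The profile is bounded for large [u]; for small [u] its exponential factor
    makes it [O(u)], and [1 - expR (- u)] is comparable to [u]. *)
Lemma profile_le a g c : 0 < a -> 0 < g -> 0 < c ->
  exists2 C, 0 < C & forall u, 0 < u -> profile a g c u <= C * (1 - expR (- u)).
Proof.
move=> a0 g0 c0.
pose b := (a + 1) / g.
have b0 : 0 < b by rewrite divr_gt0// addr_gt0.
pose C1 := (b / c) `^ b.
have C10 : 0 < C1 by rewrite powR_gt0// divr_gt0.
have e1 : (expR (-1) : R) < 1 by rewrite expR_lt1; lra.
have d0 : 0 < 1 - expR (-1) :> R by lra.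
exists (C1 * expR 1 + (1 - expR (-1))^-1).
  by rewrite addr_gt0 ?mulr_gt0 ?expR_gt0 ?invr_gt0.
move=> u u0.
have ue : 0 <= 1 - expR (- u).
  by rewrite subr_ge0 expR_le1; lra.
case: (leP 1 u) => u1.
  apply: (@le_trans _ _ 1).
    rewrite (profileE _ _ _ (ltW u0)) mulr_ile1 ?powR_ge0 ?expR_ge0//.
      by rewrite -(powRr0 u) ler_powR//; lra.
    by rewrite expR_le1 oppr_le0 mulr_ge0 ?powR_ge0// ltW.
  apply: (@le_trans _ _ ((1 - expR (-1))^-1 * (1 - expR (- u)))).
    by rewrite mulrC ler_pdivlMr// mul1r lerD2l lerN2 ler_expR lerN2.
  by rewrite ler_wpM2r// lerDr mulr_ge0 ?expR_ge0 ?(ltW C10).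
apply: (@le_trans _ _ (C1 * expR 1 * (u * expR (- u)))); last first.
  apply: (@le_trans _ _ (C1 * expR 1 * (1 - expR (- u)))).
    by rewrite ler_pM2l ?mulr_gt0 ?expR_gt0// expRN_diff_ge// ltW.
  by rewrite ler_wpM2r// lerDl invr_ge0 ltW.
apply: (@le_trans _ _ (C1 * u)); last first.
  rewrite -mulrA ler_pM2l// mulrCA -expRD ler_peMr// ?ltW//.
  by rewrite expR_gt1; lra.
have ui : 0 <= u^-1 by rewrite invr_ge0 ltW.
have := @powR_le_expR b c (u^-1 `^ g) b0 c0 (powR_ge0 _ _).
rewrite -powRrM (_ : g * b = a + 1); last by rewrite /b; field; lra.
rewrite -/C1 powRD; last by rewrite gt_eqF ?addr_gt0//.
rewrite powRr1// => H.
have e : u `^ (- a) = u * (u^-1 `^ a * u^-1).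
  by rewrite mulrCA mulfV ?gt_eqF// mulr1 powR_inv// ltW.
rewrite (profileE _ _ _ (ltW u0)) e.
apply: (@le_trans _ _ (u * (C1 * expR (c * u^-1 `^ g)) * expR (- (c * u^-1 `^ g)))).
  by rewrite ler_pM2r ?expR_gt0// ler_pM2l.
by rewrite -!mulrA expRxMexpNx_1 mulr1 mulrC.
Qed.

(** The left-hand side minus the first two terms on the right is
    [(e^-u - e^-2u) - (2 / N) (e^-Nu - e^-2Nu)]. It is negative for small [u > 0],
    its derivative at [0] being [-1], and it is at most [e^-u]. Away from [0] the
    profile is positive and decays only polynomially, so a multiple of it
    dominates [e^-u]. Keeping all terms positive lets the inequality be
    integrated without any integrability condition. *)
Lemma profile_ge a g c N : 0 < a -> 0 < g -> 0 < c -> 0 < N ->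
  exists2 C, 0 < C & forall u, 0 < u ->
    expR (- u) + 2 / N * expR (- (u * (2 * N)))
    <= expR (- (u * 2)) + 2 / N * expR (- (u * N)) + C * profile a g c u.
Proof.
move=> a0 g0 c0 N0.
(* For [u <= u0] one has [1 / 2 <= expR (- (2 * N * u))]. *)
pose u0 := (4 * N)^-1.
have u00 : 0 < u0 by rewrite invr_gt0 mulr_gt0.
have aa : 0 < (a / 1) `^ a by rewrite powR_gt0// divr_gt0.
exists ((a / 1) `^ a * expR (c * u0^-1 `^ g)); first by rewrite mulr_gt0 ?expR_gt0.
move=> u up.
have un : u != 0 by rewrite gt_eqF.
have E2 (v : R) : 0 <= v -> v * expR (- (v * 2)) <= expR (- v) - expR (- (v * 2)).
  move=> v0; have := expRN_diff_ge v0.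
  rewrite -(@ler_pM2r _ (expR (- v))) ?expR_gt0// -mulrA -expRD mulrBl -expRD mul1r.
  by have -> : - v + - v = - (v * 2) by ring.
have N2 : 0 < 2 / N by rewrite divr_gt0.
case: (leP u u0) => uu0.
  have C0 : 0 <= (a / 1) `^ a * expR (c * u0^-1 `^ g) * profile a g c u.
    by rewrite !mulr_ge0 ?profile_ge0 ?expR_ge0 ?powR_ge0.
  have h1 : expR (- u) - expR (- (u * 2)) <= u.
    have e1 : expR (- u) <= 1 by rewrite expR_le1; lra.
    have := @expR_ge1Dx _ (- (u * 2)); have := @expR_ge1Dx _ (- u).
    have : expR (- (u * 2)) = expR (- u) * expR (- u).
      by rewrite -expRD; congr expR; ring.
    have := expR_ge0 (- u); nra.
  have h2 := E2 (u * N) (ltW (mulr_gt0 up N0)).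
  have h3 : 1 / 2 <= expR (- (u * N * 2)).
    apply: le_trans (expR_ge1Dx _).
    have : u * (4 * N) <= 1.
      by rewrite -ler_pdivlMr ?mulr_gt0// mul1r.
    lra.
  have h4 : u <= 2 / N * (expR (- (u * N)) - expR (- (u * N * 2))).
    apply: le_trans (_ : 2 / N * (u * N * (1 / 2)) <= _).
      by rewrite le_eqVlt; apply/orP; left; apply/eqP; field; lra.
    rewrite ler_pM2l//; apply: le_trans h2.
    by rewrite ler_pM2l ?mulr_gt0.
  have -> : u * (2 * N) = u * N * 2 by ring.
  move: C0 h1 h4; rewrite mulrBr.
  lra.
have h1 : expR (- u) <= (a / 1) `^ a * expR (c * u0^-1 `^ g) * profile a g c u.
  have := @powR_le_expR a 1 u a0 ltr01 (ltW up); rewrite mul1r => h.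
  have h2 : u^-1 `^ g <= u0^-1 `^ g.
    have h' : u^-1 <= u0^-1 by rewrite lef_pV2 ?posrE// ltW.
    apply: (ge0_ler_powR (ltW g0)) => //; rewrite nnegrE invr_ge0 ltW//.
  have h3 : 1 <= expR (c * u0^-1 `^ g) * expR (- (c * u^-1 `^ g)).
    by rewrite -expRD -expR0 ler_expR subr_ge0 ler_pM2l.
  have ua : 0 < u `^ a by rewrite powR_gt0.
  have h4 : expR (- u) <= (a / 1) `^ a * u `^ (- a).
    rewrite powRN expRN -(@ler_pM2r _ (u `^ a)) // -mulrA mulVf ?gt_eqF// mulr1.
    by rewrite mulrC ler_pdivrMr ?expR_gt0.
  apply: (le_trans h4); rewrite (profileE _ _ _ (ltW up)).
  rewrite [leRHS](_ : _ = (a / 1) `^ a * u `^ (- a) *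
    (expR (c * u0^-1 `^ g) * expR (- (c * u^-1 `^ g)))); last by ring.
  by rewrite ler_peMr// mulr_ge0 ?powR_ge0.
have h2 : expR (- (u * (2 * N))) <= expR (- (u * N)).
  by rewrite ler_expR lerN2 ler_pM2l//; lra.
have h3 := expR_ge0 (- (u * 2)).
have : 2 / N * expR (- (u * (2 * N))) <= 2 / N * expR (- (u * N)) by rewrite ler_pM2l.
lra.
Qed.

End elementary_inequalities.

(** * Integrals against the density of the subordinator *)

(** The integral of a nonnegative function is a supremum over the simple
    functions below it, so it is monotone even off the measurable functions. *)
Lemma ge0_le_integralW d (T : measurableType d) (R : realType)
    (m : {measure set T -> \bar R}) (D : set T) (f g : T -> \bar R) :
  (forall x, D x -> 0 <= f x)%E -> (forall x, D x -> f x <= g x)%E ->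
  (\int[m]_(x in D) f x <= \int[m]_(x in D) g x)%E.
Proof.
move=> f0 fg.
have g0 x : D x -> (0 <= g x)%E by move=> Dx; apply: le_trans (fg x Dx); apply: f0.
rewrite !ge0_integralE//; apply: le_ereal_sup => _ [h /= hf <-]; exists h => // x.
apply: (le_trans (hf x)); rewrite !patchE; case: ifPn => // /set_mem; exact: fg.
Qed.

Section subordinator.
Context {R : realType}.
Variables (delta : R) (eta : R -> R -> R).
Hypothesis eta_density : subordinator_density delta eta.
Let I : set R := [set` `]0%R, +oo[].

Let mI : measurable I. Proof. exact: measurable_itv. Qed.

Let I_gt0 s : I s -> 0 < s. Proof. by rewrite /I/= in_itv/= andbT. Qed.

Lemma measurable_density t : 0 < t -> measurable_fun I (eta t).
Proof.
move=> t0; have [c _ _] := eta_density t0.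
exact: subspace_continuous_measurable_fun.
Qed.

Lemma density_ge0 t s : 0 < t -> I s -> 0 <= eta t s.
Proof. by move=> t0 /I_gt0 s0; have [_ + _] := eta_density t0; apply. Qed.

(** The Laplace transform after rescaling the time by [r], so that only
    [t * r `^ (- delta)] matters. *)
Lemma laplace_density t r b : 0 < t -> 0 < r -> 0 < b ->
  (\int[lebesgue_measure]_(s in I) (eta t s * expR (- (s / r * b)))%:E
   = (expR (- (t * r `^ (- delta) * b `^ delta)))%:E)%E.
Proof.
move=> t0 r0 b0; have [_ _ /(_ (b / r))] := eta_density t0.
rewrite divr_gt0// => /(_ isT) L.
have -> : t * r `^ (- delta) * b `^ delta = t * (b / r) `^ delta.
  by rewrite powRM ?invr_ge0 ?ltW// powR_inv ?ltW//; ring.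
rewrite -L; apply: eq_integral => s _.
by rewrite (_ : s / r * b = s * (b / r))//; ring.
Qed.

Let measurable_laplace_real t r b : 0 < t ->
  measurable_fun I (fun s => eta t s * expR (- (s / r * b))).
Proof.
move=> t0; apply: measurable_funM; first exact: measurable_density.
apply: measurable_funTS; apply: measurableT_comp => //.
apply: measurableT_comp => //; apply: measurable_funM => //.
exact: measurable_funM.
Qed.

Lemma measurable_laplace t r b : 0 < t ->
  measurable_fun I (fun s => (eta t s * expR (- (s / r * b)))%:E).
Proof. by move=> t0; apply/measurable_EFinP; exact: measurable_laplace_real. Qed.

(** Monotone convergence in the Laplace transform at [1 / n.+1]. *)
Lemma density_mass_le1 t : 0 < t ->
  (\int[lebesgue_measure]_(s in I) (eta t s)%:E <= 1)%E.
Proof.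
move=> t0.
pose g (n : nat) (s : R) := (eta t s * expR (- (s / n.+1%:R * 1)))%:E.
have gE s : g ^~ s n @[n --> \oo] --> (eta t s)%:E.
  have h : s / n.+1%:R * 1 @[n --> \oo] --> (0 : R).
    under eq_fun do rewrite mulr1.
    by rewrite -(mulr0 s); apply: cvgM; [exact: cvg_cst|exact: cvg_harmonic].
  apply/cvg_EFin; first by near=> n.
  rewrite /g/= -[X in _ --> X]mulr1; apply: cvgM; first exact: cvg_cst.
  rewrite -[X in _ --> X]expR0; apply: continuous_cvg; first exact: continuous_expR.
  by rewrite -[X in _ --> X]oppr0; exact: cvgN.
have mg n : measurable_fun I (g n) by exact: measurable_laplace.
have g0 n s : I s -> (0 <= g n s)%E.
  by move=> Is; rewrite lee_fin mulr_ge0 ?expR_ge0 ?density_ge0.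
have gnd s : I s -> nondecreasing_seq (g ^~ s).
  move=> Is m n mn; rewrite lee_fin ler_wpM2l ?density_ge0// ler_expR lerN2 !mulr1.
  by rewrite ler_pM2l ?I_gt0// lef_pV2 ?posrE// ler_nat ltnS.
rewrite (_ : (\int[_]_(s in _) _)%E =
  (\int[lebesgue_measure]_(s in I) limn (g ^~ s))%E); last first.
  by apply: eq_integral => s _; apply/esym/cvg_lim.
rewrite monotone_convergence//.
apply: lime_le.
  apply: ereal_nondecreasing_is_cvgn => m n mn.
  by apply: ge0_le_integralW => s Is; [exact: g0|exact: gnd].
apply: nearW => n; rewrite laplace_density// lee_fin expR_le1.
by rewrite oppr_le0 !mulr_ge0 ?powR_ge0// ltW.
Unshelve. all: by end_near. Qed.

Lemma measurable_profile a g c r t : 0 < t ->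
  measurable_fun I (fun s => (eta t s * profile a g c (s / r))%:E).
Proof.
move=> t0; apply/measurable_EFinP/measurable_funM; first exact: measurable_density.
apply: measurable_funTS.
have mr : measurable_fun setT (fun s : R => s / r) by exact: measurable_funM.
have mp b : measurable_fun setT (fun s : R => (s / r) `^ b).
  exact: (measurableT_comp (measurable_powR b) mr).
apply: measurable_funM => //; apply: measurableT_comp => //.
by apply: measurableT_comp => //; apply: measurable_funM.
Qed.

(** With [x = t * r `^ (- delta)], the integral of [1 - expR (- s / r)] against
    the density is at most [1 - expR (- x)], hence at most [x `^ th]. The freedom
    in [th] replaces a separate estimate of the kernel near the diagonal. *)
Lemma subordinated_profile_le a g c : 0 < a -> 0 < g -> 0 < c ->
  exists2 C, 0 < C & forall t r th, 0 < t -> 0 < r -> 0 <= th <= 1 ->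
    (\int[lebesgue_measure]_(s in I) (eta t s * profile a g c (s / r))%:E
     <= (C * (t * r `^ (- delta)) `^ th)%:E)%E.
Proof.
move=> a0 g0 c0; have [C C0 H] := profile_le a0 g0 c0.
exists C => // t r th t0 r0 /andP[th0 th1].
have k0 s : I s -> 0 <= 1 - expR (- (s / r * 1)).
  by move=> /I_gt0 s0; rewrite subr_ge0 expR_le1 oppr_le0 mulr1 divr_ge0 ?ltW.
have mk : measurable_fun I (fun s => (eta t s * (1 - expR (- (s / r * 1))))%:E).
  apply/measurable_EFinP.
  rewrite (_ : (fun _ => _) = (fun s => eta t s - eta t s * expR (- (s / r * 1)))).
    apply: measurable_funB; first exact: measurable_density.
    exact: measurable_laplace_real.
  by apply/funext => s; rewrite mulrBr (mulr1 (eta t s)).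
apply: (@le_trans _ _ (\int[lebesgue_measure]_(s in I)
    (C%:E * (eta t s * (1 - expR (- (s / r * 1))))%:E))%E).
  apply: ge0_le_integralW => [s Is|s Is] /=.
    by rewrite lee_fin mulr_ge0 ?profile_ge0 ?density_ge0.
  rewrite -EFinM lee_fin [leRHS]mulrCA ler_wpM2l ?density_ge0// mulr1.
  by apply: H; rewrite divr_gt0// I_gt0.
rewrite ge0_integralZl_EFin ?(ltW C0)//; last first.
  by move=> s Is; rewrite lee_fin mulr_ge0 ?density_ge0// k0.
rewrite EFinM lee_pmul2l ?lte_fin//.
set x := t * r `^ (- delta).
have x0 : 0 < x by rewrite mulr_gt0 ?powR_gt0.
apply: (@le_trans _ _ (1 - expR (- x))%:E); last first.
  rewrite lee_fin; have [x1|x1] := leP 1 x.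
    apply: (@le_trans _ _ 1); first by have := expR_ge0 (- x); lra.
    by rewrite -(powRr0 x) ler_powR.
  apply: (@le_trans _ _ x); first by have := @expR_ge1Dx _ (- x); lra.
  by apply: ger1_powR => //; rewrite x0 (ltW x1).
have := density_mass_le1 t0.
have -> : (\int[lebesgue_measure]_(s in I) (eta t s)%:E =
    \int[lebesgue_measure]_(s in I) ((eta t s * expR (- (s / r * 1)))%:E
    + (eta t s * (1 - expR (- (s / r * 1))))%:E))%E.
  by apply: eq_integral => s _; rewrite -EFinD; congr EFin; ring.
rewrite ge0_integralD//; last 3 first.
- by move=> s Is; rewrite lee_fin mulr_ge0 ?expR_ge0 ?density_ge0.
- exact: measurable_laplace.
- by move=> s Is; rewrite lee_fin mulr_ge0 ?density_ge0// k0.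
rewrite laplace_density// powR1 /= mulr1 -/x addeC => h.
by rewrite EFinB leeBrDr.
Qed.

(** Integrate [profile_ge]. With [x = t * r `^ (- delta)], the combination of
    exponentials integrates, to first order in [x], to
    [(2 `^ delta - 1) * (1 - 2 * N `^ (delta - 1)) * x], although its derivative
    at the origin is negative: since [delta < 1], a large [N] makes this
    positive. *)
Lemma subordinated_profile_ge a g c : 0 < a -> 0 < g -> 0 < c ->
    0 < delta -> delta < 1 ->
  exists2 k, 0 < k & forall t r, 0 < t -> 0 < r -> t <= r `^ delta ->
    ((k * (t * r `^ (- delta)))%:E <=
     \int[lebesgue_measure]_(s in I) (eta t s * profile a g c (s / r))%:E)%E.
Proof.
move=> a0 g0 c0 d0 d1.
(* This makes [2 * N `^ (delta - 1)] half of [expR (- 2)]; the factor [expR (- 2)]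
   is lost in [h1] by estimating over all [x <= 1] and not just to first order. *)
pose N : R := (4 * expR 2) `^ (1 - delta)^-1.
have N0 : 0 < N by rewrite powR_gt0// mulr_gt0 ?expR_gt0.
have N2 : 0 < 2 / N by rewrite divr_gt0.
have Nd : 2 / N * N `^ delta = expR (- 2) / 2.
  have : N `^ (1 - delta) = 4 * expR 2.
    by rewrite -powRrM mulVf ?powRr1 ?mulr_ge0 ?expR_ge0//; lra.
  have Ndp : N `^ delta != 0 by rewrite gt_eqF// powR_gt0.
  rewrite powRB ?(gt_eqF N0) ?implybT// powRr1 ?ltW// => h.
  rewrite expRN.
  rewrite {1}(_ : N = 4 * expR 2 * N `^ delta); last by rewrite -h divfK.
  by field; rewrite Ndp gt_eqF ?expR_gt0.
have [C C0 H] := profile_ge a0 g0 c0 N0.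
pose m : R := 2 `^ delta.
have m1 : 1 < m.
  by have := gt0_ltr_powR d0; move=> /(_ 1 2); rewrite !nnegrE powR1; apply=> //; lra.
have m2 : m <= 2 by rewrite -[leRHS]powRr1// ler_powR ?ler1n// (ltW d1).
pose k := expR (- 2) / 2 * (m - 1).
have k0 : 0 < k by rewrite mulr_gt0 ?divr_gt0 ?expR_gt0// subr_gt0.
exists (k / C); first by rewrite divr_gt0.
move=> t r t0 r0 tr; set x := t * r `^ (- delta).
have x0 : 0 < x by rewrite mulr_gt0 ?powR_gt0.
have x1 : x <= 1 by rewrite /x powRN ler_pdivrMr ?powR_gt0// mul1r.
rewrite -(@lee_pmul2l _ C%:E)// -EFinM (_ : C * (k / C * x) = k * x); last by field; lra.
have eb (b : R) s : I s -> (0 <= (eta t s * expR (- (s / r * b)))%:E)%E.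
  by move=> Is; rewrite lee_fin mulr_ge0 ?expR_ge0 ?density_ge0.
have ek (q b : R) s : 0 < q -> I s -> (0 <= q%:E * (eta t s * expR (- (s / r * b)))%:E)%E.
  by move=> q0 Is; rewrite mule_ge0 ?eb ?lee_fin ?ltW.
have mb (b : R) := @measurable_laplace t r b t0.
have mq (q b : R) : measurable_fun I (fun s => q%:E * (eta t s * expR (- (s / r * b)))%:E)%E.
  exact: measurable_funeM.
have P0 s : I s -> (0 <= (eta t s * profile a g c (s / r))%:E)%E.
  by move=> Is; rewrite lee_fin mulr_ge0 ?profile_ge0 ?density_ge0.
have mP := @measurable_profile a g c r t t0.
have lap2 (q b b' : R) : 0 < q -> 0 < b -> 0 < b' ->
    (\int[lebesgue_measure]_(s in I) ((eta t s * expR (- (s / r * b)))%:E +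
       q%:E * (eta t s * expR (- (s / r * b')))%:E) =
    (expR (- (x * b `^ delta)) + q * expR (- (x * b' `^ delta)))%:E)%E.
  move=> q0 b0 b'0; rewrite ge0_integralD; [|exact: mI|by move=> s; exact: eb|exact: mb
    |by move=> s; exact: ek|exact: mq].
  rewrite ge0_integralZl_EFin; [|exact: mI|by move=> s; exact: eb|exact: mb|exact: ltW].
  by rewrite !laplace_density.
have : (\int[lebesgue_measure]_(s in I) ((eta t s * expR (- (s / r * 1)))%:E +
       (2 / N)%:E * (eta t s * expR (- (s / r * (2 * N))))%:E) <=
   \int[lebesgue_measure]_(s in I) ((eta t s * expR (- (s / r * 2)))%:E +
       (2 / N)%:E * (eta t s * expR (- (s / r * N)))%:E
       + C%:E * (eta t s * profile a g c (s / r))%:E))%E.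
  apply: ge0_le_integralW => [s Is|s Is] /=; first by rewrite adde_ge0 ?eb ?ek.
  rewrite -!EFinM -!EFinD lee_fin mulr1.
  have sr : 0 < s / r by rewrite divr_gt0// I_gt0.
  have := ler_wpM2l (density_ge0 t0 Is) (H _ sr).
  by rewrite !mulrDr !(mulrCA (eta t s)).
rewrite [leRHS]ge0_integralD; [|exact: mI|by move=> s Is; rewrite adde_ge0 ?eb ?ek
  |by apply: emeasurable_funD; [exact: mb|exact: mq]|by move=> s Is; rewrite mule_ge0 ?P0 ?lee_fin ?(ltW C0)
  |exact: measurable_funeM].
rewrite ge0_integralZl_EFin ?(ltW C0)// !lap2// ?mulr_gt0// -leeBlDl//.
apply: le_trans; rewrite -EFinB lee_fin.
rewrite powR1 /= mulr1 powRM ?(ltW N0)// -/m.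
set y := N `^ delta.
have h1 : expR (- 2) * ((m - 1) * x) <= expR (- x) - expR (- (x * m)).
  have -> : expR (- x) - expR (- (x * m)) = expR (- (x * m)) * (expR ((m - 1) * x) - 1).
    by rewrite mulrBr mulr1 -expRD; congr (expR _ - _); ring.
  apply: ler_pM; first exact: expR_ge0.
  - by rewrite mulr_ge0 ?(ltW x0)// subr_ge0 ltW.
  - by rewrite ler_expR lerN2; nra.
  - by have := @expR_ge1Dx _ ((m - 1) * x); lra.
have h2 : expR (- (x * y)) - expR (- (x * (m * y))) <= (m - 1) * x * y.
  have y0 : 0 <= x * y by rewrite mulr_ge0 ?powR_ge0 ?ltW.
  have -> : expR (- (x * (m * y))) = expR (- (x * y)) * expR (- ((m - 1) * (x * y))).
    by rewrite -expRD; congr expR; ring.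
  have e1 : expR (- (x * y)) <= 1 by rewrite expR_le1; lra.
  have e0 := expR_ge0 (- (x * y)).
  have := @expR_ge1Dx _ (- ((m - 1) * (x * y))).
  set z := expR (- ((m - 1) * (x * y))) => hz.
  have z1 : z <= 1 by rewrite expR_le1 oppr_le0 mulr_ge0//; lra.
  nra.
have h3 : 2 / N * (expR (- (x * y)) - expR (- (x * (m * y))))
    <= expR (- 2) / 2 * ((m - 1) * x).
  rewrite -Nd; apply: le_trans (_ : 2 / N * ((m - 1) * x * y) <= _).
    by rewrite ler_pM2l.
  by rewrite -/y le_eqVlt; apply/orP; left; apply/eqP; ring.
move: h1 h3; rewrite /k mulrBr; lra.
Qed.

End subordinator.

(** * Pointwise bounds on the subordinated kernel *)

Section borel_metric_space.
Context (R : realType) (d : measure_display) (X : borelMetricType R d).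
Implicit Types (U : set X) (x y : X).

Lemma open_measurable_borel U : open U -> measurable U.
Proof. by move=> oU; rewrite borel_measurableE; exact: sub_gen_smallest. Qed.

Lemma mdist_ball_open x (r : R) : open [set y | mdist x y < r].
Proof.
rewrite -ballEmdist openE => y; rewrite ballEmdist/= => xyr.
apply/nbhs_ballP; exists (r - mdist x y) => /=; first by rewrite subr_gt0.
move=> z; rewrite !ballEmdist/= => yz.
by rewrite (le_lt_trans (metric_triangle _ y _))// -ltrBrDl.
Qed.

Lemma ball_measurable x (r : R) : measurable (ball x r).
Proof. by apply: open_measurable_borel; rewrite ballEmdist; exact: mdist_ball_open. Qed.

Lemma mdist_continuous : continuous (fun z : X * X => mdist z.1 z.2 : R).
Proof.
move=> [x y]; apply/cvgrPdist_lt => /= e e0.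
exists (ball x (e / 2), ball y (e / 2)) => /=.
  by split; apply: nbhsx_ballx; rewrite divr_gt0.
move=> [u v] /=; rewrite !ballEmdist/= => -[xu yv].
have := metric_triangle x u y; have := metric_triangle u v y.
have := metric_triangle u x v; have := metric_triangle x y v.
rewrite (metric_sym u x) (metric_sym v y) => h1 h2 h3 h4.
rewrite ltr_norml; apply/andP; split; lra.
Qed.

(** A strict inequality at one point persists on a product of two balls, which
    has positive measure by full support. *)
Lemma ae_le_continuous (mu : {sigma_finite_measure set X -> \bar R})
    (u v : X * X -> R) : full_support mu -> continuous u -> continuous v ->
  {ae (mu \x mu)%E, forall z, u z <= v z} -> forall z, u z <= v z.
Proof.
move=> fs cu cv [N [mN N0 sN]] [x y]; rewrite leNgt; apply/negP => vu.
have : \forall z \near (x, y), v z < u z.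
  have : \forall z \near (x, y), 0 < u z - v z.
    have cuv : u z - v z @[z --> (x, y)] --> u (x, y) - v (x, y).
      by apply: cvgB; [exact: cu|exact: cv].
    by apply: (cvgr_gt _ cuv); rewrite subr_gt0.
  by apply: filterS => z; rewrite subr_gt0.
case=> -[A B] /= [/nbhs_ballP[r /= r0 rA] /nbhs_ballP[s /= s0 sB]] AB.
have : (0 < (mu \x mu)%E (ball x r `*` ball y s))%E.
  rewrite product_measure1E; [|exact: ball_measurable..].
  have pos (z : X) (q : R) : 0 < q -> (0 < mu (ball z q))%E.
    move=> q0; apply: fs; first by rewrite ballEmdist; exact: mdist_ball_open.
    by exists z; exact: ballxx.
  by rewrite mule_gt0 ?pos.
suff : ((mu \x mu)%E (ball x r `*` ball y s) <= 0)%E by rewrite leNgt => /negbTE ->.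
rewrite -N0; apply: le_measure; rewrite ?inE//.
  by apply: measurableX; exact: ball_measurable.
move=> [z1 z2] [/= zx zy]; apply: sN => /= zle.
by have := AB (z1, z2) (conj (rA _ zx) (sB _ zy)); rewrite /= ltNge zle.
Qed.

End borel_metric_space.

Section subordinated_bounds.
Context (R : realType).

(** The absolute value matters: [powR] takes the value [1] at negative numbers,
    so that [powR ^~ q] is not continuous at [0]. *)
Lemma continuous_powR_norm (q : R) : 0 < q -> continuous (fun x : R => `|x| `^ q).
Proof.
move=> q0 x; have [->|x0] := eqVneq x 0.
  apply/cvgrPdist_lt => e e0; rewrite normr0 powR0 ?gt_eqF//.
  near=> y; rewrite sub0r normrN ger0_norm ?powR_ge0//.
  have ye : `|y| < e `^ q^-1.
    near: y; apply/nbhs_ballP; exists (e `^ q^-1); first by rewrite /= powR_gt0.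
    by move=> z; rewrite /ball/= sub0r normrN.
  have := gt0_ltr_powR q0; move=> /(_ `|y| (e `^ q^-1)).
  rewrite !nnegrE normr_ge0 powR_ge0 -powRrM mulVf ?gt_eqF// powRr1 ?ltW//; exact.
have hn : `|y| @[y --> x] --> `|x| by exact: norm_continuous.
have hc : {for `|x|, continuous (fun y : R => y `^ q)}.
  apply: differentiable_continuous; apply/derivable1_diffP.
  by apply: derivable_powR; rewrite in_itv/= andbT normr_gt0.
exact: (continuous_cvg _ hc hn).
Unshelve. all: by end_near. Qed.

Lemma sub_gaussian_continuous d (X : borelMetricType R d) (dH dW c c' t : R) :
  1 < dW -> 0 < t ->
  continuous (fun z : X * X => sub_gaussian dH dW c c' t z.1 z.2).
Proof.
move=> dW1 t0.
have dW0 : 0 < dW by exact: lt_trans dW1.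
have g0 : 0 < (dW - 1)^-1 by rewrite invr_gt0 subr_gt0.
have e (z : X * X) : sub_gaussian dH dW c c' t z.1 z.2 =
    c * t `^ (- (dH / dW)) *
    expR (- (c' * `|(`|mdist z.1 z.2| `^ dW / t)| `^ (dW - 1)^-1)).
  rewrite /sub_gaussian (ger0_norm (mdist_ge0 _ _)).
  by rewrite [in RHS]ger0_norm// divr_ge0 ?powR_ge0 ?ltW.
rewrite (_ : (fun _ => _) = (fun z : X * X => c * t `^ (- (dH / dW)) *
    expR (- (c' * `|(`|mdist z.1 z.2| `^ dW / t)| `^ (dW - 1)^-1)))); last first.
  by apply/funext => z; exact: e.
move=> z; apply: cvgM; first exact: cvg_cst.
apply: continuous_cvg; first exact: continuous_expR.
apply: cvgN; apply: cvgM; first exact: cvg_cst.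
have cD : `|mdist z.1 z.2| `^ dW @[z --> z] --> `|mdist z.1 z.2| `^ dW.
  have hm : mdist z.1 z.2 @[z --> z] --> (mdist z.1 z.2 : R) by exact: mdist_continuous.
  have hc : {for (mdist z.1 z.2 : R), continuous (fun y : R => `|y| `^ dW)}.
    exact: continuous_powR_norm.
  exact: (continuous_cvg _ hc hm).
have cDt : `|mdist z.1 z.2| `^ dW / t @[z --> z] --> `|mdist z.1 z.2| `^ dW / t.
  by apply: cvgM; [exact: cD|exact: cvg_cst].
have hc : {for `|mdist z.1 z.2| `^ dW / t,
    continuous (fun y : R => `|y| `^ (dW - 1)^-1)}.
  exact: continuous_powR_norm.
exact: (continuous_cvg _ hc cDt).
Qed.

Lemma profile_scale (a g c r s : R) : 0 < r -> 0 < s ->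
  r `^ (- a) * profile a g c (s / r) = s `^ (- a) * expR (- (c * (r / s) `^ g)).
Proof.
move=> r0 s0; rewrite /profile -(@powR_inv _ (s / r) g) ?divr_ge0 ?(ltW r0) ?(ltW s0)// invf_div mulrA.
rewrite -powRM ?divr_ge0 ?(ltW r0) ?(ltW s0)//.
by rewrite (_ : r * (s / r) = s)// mulrC divfK ?gt_eqF.
Qed.

(** The subordinated kernel integrates [p] over all times at a fixed pair of
    points, so bounds off a null set depending on the time would not do. *)
Lemma sub_gaussian_bounds_everywhere d (X : borelMetricType R d)
    (mu : {sigma_finite_measure set X -> \bar R})
    (p : R -> X -> X -> R) (dH dW : R) : full_support mu -> 1 < dW ->
  (forall t : R, 0 < t -> continuous (fun z : X * X => p t z.1 z.2)) ->
  sub_gaussian_bounds mu p dH dW ->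
  exists c3 c4 c5 c6 : R, [/\ 0 < c3, 0 < c4, 0 < c5, 0 < c6 &
    forall t x y, 0 < t -> sub_gaussian dH dW c5 c6 t x y <= p t x y
          <= sub_gaussian dH dW c3 c4 t x y].
Proof.
move=> fs dW1 cp [c3 [c4 [c5 [c6 [c30 c40 c50 c60 H]]]]].
exists c3, c4, c5, c6; split => // t x y t0.
have cs c c' := @sub_gaussian_continuous _ X dH dW c c' t dW1 t0.
apply/andP; split.
  apply: (ae_le_continuous fs (cs _ _) (cp t t0) _ (x, y)).
  by apply: filterS (H t t0) => z /andP[].
apply: (ae_le_continuous fs (cp t t0) (cs _ _) _ (x, y)).
by apply: filterS (H t t0) => z /andP[].
Qed.


(** Apply [subordinated_profile_le] at the scale [mdist x y `^ dW]. *)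
Lemma subordinated_kernel_le d (X : borelMetricType R d)
    (p : R -> X -> X -> R) (dH dW c c' delta : R) (eta : R -> R -> R) :
  0 < dH -> 1 < dW -> 0 < c -> 0 < c' -> subordinator_density delta eta ->
  (forall t x y, 0 < t -> 0 <= p t x y <= sub_gaussian dH dW c c' t x y) ->
  exists2 C, 0 < C & forall t th x y, 0 < t -> 0 <= th <= 1 -> x != y ->
    (subordinated_kernel eta p t x y
      <= (C * t `^ th * mdist x y `^ (- (dH + th * delta * dW)))%:E)%E.
Proof.
move=> dH0 dW1 c0 c'0 etad pH.
have dW0 : 0 < dW by exact: lt_trans dW1.
have a0 : 0 < dH / dW by rewrite divr_gt0.
have g0 : 0 < (dW - 1)^-1 by rewrite invr_gt0 subr_gt0.
have [C C0 H] := subordinated_profile_le etad a0 g0 c'0.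
exists (c * C); first by rewrite mulr_gt0.
move=> t th x y t0 th01 xy; rewrite -mdist_gt0 in xy.
set D := mdist x y `^ dW; have D0 : 0 < D by rewrite powR_gt0.
rewrite /subordinated_kernel.
have := H t D th t0 D0 th01.
set Q := (X in (X <= _)%E) => HQ.
apply: (@le_trans _ _ ((c * D `^ (- (dH / dW)))%:E * Q)%E); last first.
  apply: (@le_trans _ _ ((c * D `^ (- (dH / dW)))%:E *
      (C * (t * D `^ (- delta)) `^ th)%:E)%E).
    by rewrite lee_pmul2l// lte_fin mulr_gt0 ?powR_gt0.
  rewrite -EFinM lee_fin powRM ?powR_ge0 ?(ltW t0)// /D -!powRrM.
  rewrite (_ : - (dH + th * delta * dW) = dW * - (dH / dW) + dW * (- delta * th));
    last by field; lra.
  rewrite powRD ?(gt_eqF xy) ?implybT// le_eqVlt; apply/orP; left; apply/eqP.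
  by ring.
have mI : measurable ([set` `]0%R, +oo[] : set R) by exact: measurable_itv.
rewrite /Q -ge0_integralZl_EFin; [|exact: mI| |exact: (measurable_profile etad)|]; last 2 first.
- move=> s /=; rewrite in_itv/= andbT => s0.
  by rewrite lee_fin mulr_ge0 ?profile_ge0 ?(density_ge0 etad)//= in_itv/= s0.
- by rewrite mulr_ge0 ?powR_ge0 ?ltW.
apply: ge0_le_integralW => s /=; rewrite in_itv/= andbT => s0.
  rewrite lee_fin mulr_ge0 ?(density_ge0 etad)//= ?in_itv/= ?s0//.
  by have /andP[] := pH s x y s0.
rewrite -EFinM lee_fin [leRHS]mulrCA ler_wpM2l ?(density_ge0 etad)//= ?in_itv/= ?s0//.
rewrite -mulrA profile_scale// mulrA.
by have /andP[] := pH s x y s0.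
Qed.

(** The sub-Gaussian factor decreases with the distance, so it is at least its
    value at [rho]: apply [subordinated_profile_ge] at the scale [rho `^ dW]. *)
Lemma subordinated_kernel_ge d (X : borelMetricType R d)
    (p : R -> X -> X -> R) (dH dW c c' delta : R) (eta : R -> R -> R) :
  0 < dH -> 1 < dW -> 0 < c -> 0 < c' -> 0 < delta < 1 ->
  subordinator_density delta eta ->
  (forall t x y, 0 < t -> sub_gaussian dH dW c c' t x y <= p t x y) ->
  exists2 k, 0 < k & forall t rho x y, 0 < t -> 0 < rho ->
    mdist x y <= rho -> t <= rho `^ (delta * dW) ->
    ((k * t * rho `^ (- (dH + delta * dW)))%:E <= subordinated_kernel eta p t x y)%E.
Proof.
move=> dH0 dW1 c0 c'0 /andP[d0 d1] etad pH.
have dW0 : 0 < dW by exact: lt_trans dW1.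
have a0 : 0 < dH / dW by rewrite divr_gt0.
have g0 : 0 < (dW - 1)^-1 by rewrite invr_gt0 subr_gt0.
have [C C0 H] := subordinated_profile_ge etad a0 g0 c'0 d0 d1.
exists (c * C); first by rewrite mulr_gt0.
move=> t rho x y t0 rho0 xy trho.
set D := rho `^ dW; have D0 : 0 < D by rewrite powR_gt0.
rewrite /subordinated_kernel.
have := H t D t0 D0; rewrite -powRrM (mulrC dW) => /(_ trho).
set Q := (X in (_ <= X)%E) => HQ.
apply: (@le_trans _ _ ((c * D `^ (- (dH / dW)))%:E * Q)%E).
  apply: (@le_trans _ _ ((c * D `^ (- (dH / dW)))%:E *
      (C * (t * D `^ (- delta)))%:E)%E); last first.
    by rewrite lee_pmul2l// lte_fin mulr_gt0 ?powR_gt0.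
  rewrite -EFinM lee_fin /D -!powRrM.
  rewrite (_ : - (dH + delta * dW) = dW * - (dH / dW) + dW * - delta);
    last by field; lra.
  rewrite powRD ?(gt_eqF rho0) ?implybT// le_eqVlt; apply/orP; left; apply/eqP.
  by ring.
have mI : measurable ([set` `]0%R, +oo[] : set R) by exact: measurable_itv.
rewrite /Q -ge0_integralZl_EFin; [|exact: mI| |exact: (measurable_profile etad)|]; last 2 first.
- move=> s /=; rewrite in_itv/= andbT => s0.
  by rewrite lee_fin mulr_ge0 ?profile_ge0 ?(density_ge0 etad)//= in_itv/= s0.
- by rewrite mulr_ge0 ?powR_ge0 ?ltW.
apply: ge0_le_integralW => s /=; rewrite in_itv/= andbT => s0.
  rewrite mule_ge0// lee_fin mulr_ge0 ?profile_ge0 ?powR_ge0 ?(ltW c0)//.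
  by rewrite ?(density_ge0 etad)//= ?in_itv/= ?s0.
rewrite -EFinM lee_fin [leLHS]mulrCA ler_wpM2l ?(density_ge0 etad)//= ?in_itv/= ?s0//.
rewrite -mulrA profile_scale// mulrA; apply: le_trans (pH s x y s0).
rewrite /sub_gaussian; apply: ler_wpM2l; first by rewrite mulr_ge0 ?powR_ge0// ltW.
rewrite ler_expR lerN2; apply: ler_wpM2l; first exact: ltW.
have h : mdist x y `^ dW / s <= D / s.
  rewrite ler_pM2r ?invr_gt0//.
  by apply: (ge0_ler_powR (ltW dW0)) => //; rewrite nnegrE ?mdist_ge0 ?ltW.
by apply: (ge0_ler_powR (ltW g0)) => //; rewrite nnegrE divr_ge0 ?powR_ge0 ?ltW.
Qed.

End subordinated_bounds.

(** * Oscillation at a given scale *)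

Section oscillation.
Context (R : realType) (d : measure_display) (X : borelMetricType R d).
Implicit Types (x y : X) (f : X -> R) (r : R).

(** Each closed ball around [x0] with integer radius is covered by finitely many
    balls of radius [m.+1%:R^-1]; the sequence lists all their centers. *)
Lemma proper_separable : proper_metric X -> X ->
  exists s : nat -> X, forall x (e : R), 0 < e -> exists k, mdist (s k) x < e.
Proof.
move=> prop x0.
have cov (n m : nat) : finite_subset_cover setT
    (fun z : X => [set y | mdist z y < m.+1%:R^-1 :> R]) (closure (ball x0 (n%:R : R))).
  have := prop x0 n%:R; rewrite compact_cover; apply.
    by move=> z _; exact: mdist_ball_open.
  by move=> z _; exists z => //=; rewrite mdistxx.
have [D hD] : exists D : nat -> nat -> {fset X}, forall n m,
    closure (ball x0 (n%:R : R)) `<=`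
      cover [set` D n m] (fun z : X => [set y | mdist z y < m.+1%:R^-1 :> R]).
  exists (fun n m => projT1 (cid2 (cov n m))) => n m.
  by case: (cid2 (cov n m)).
exists (fun k => if (choice.unpickle k : option (nat * nat * nat)) is Some nmi then
  nth x0 (D nmi.1.1 nmi.1.2) nmi.2 else x0) => x e e0.
pose n := (Num.truncn (mdist x0 x)).+1.
have xn : closure (ball x0 (n%:R : R)) x.
  by apply: subset_closure; rewrite ballEmdist/= truncnS_gt.
have [m] := ltr_add_invr e0; rewrite add0r => me.
have [q /= qD qx] := hD n m x xn.
exists (choice.pickle (n, m, index q (D n m))).
by rewrite choice.pickleK/= nth_index//; exact: lt_trans me.
Qed.

(** Separability writes this open set as a countable union of products of balls,
    which places it in the product sigma-algebra. *)
Lemma measurable_near_diagonal r : proper_metric X ->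
  measurable [set z : X * X | mdist z.1 z.2 < r].
Proof.
move=> prop; have [[x0 _]|X0] := pselect (exists x : X, True); last first.
  rewrite (_ : [set _ | _] = set0)//; apply/seteqP; split => // -[x y] _.
  by exfalso; apply: X0; exists x.
have [s ds] := proper_separable prop x0.
pose e (m : nat) : R := m.+1%:R^-1.
rewrite (_ : [set _ | _] =
    \bigcup_m \bigcup_k (ball (s k) (e m) `*` ball (s k) (r - e m))).
  apply: bigcupT_measurable => m; apply: bigcupT_measurable => k.
  by apply: measurableX; exact: ball_measurable.
apply/seteqP; split => [[x y] /= xyr|[x y] [m _ [k _]]] /=.
  have h : 0 < (r - mdist x y) / 2 by rewrite divr_gt0 ?subr_gt0.
  have [m] := ltr_add_invr h; rewrite add0r => me.
  have e0 : 0 < e m by rewrite invr_gt0.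
  have [k kx] := ds x _ e0.
  exists m => //; exists k => //=; rewrite !ballEmdist/=; split => //.
  rewrite (le_lt_trans (metric_triangle (s k) x y))//.
  move: me kx; rewrite -/(e m); lra.
rewrite !ballEmdist/= => -[qx qy].
rewrite (le_lt_trans (metric_triangle x (s k) y))// (metric_sym x).
by move: qx qy; lra.
Qed.

Definition local_diff f r (z : X * X) : R :=
  if mdist z.1 z.2 < r then `|f z.1 - f z.2| else 0.

Lemma local_diff_ge0 f r z : 0 <= local_diff f r z.
Proof. by rewrite /local_diff; case: ifP. Qed.

Lemma measurable_local_diff f r : proper_metric X -> measurable_fun setT f ->
  measurable_fun setT (fun z => (local_diff f r z)%:E).
Proof.
move=> prop mf; apply/measurable_EFinP; apply: measurable_fun_ifT => //.
  apply: (measurable_fun_bool true).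
  rewrite setTI (_ : _ @^-1` _ = [set z : X * X | mdist z.1 z.2 < r]).
    exact: measurable_near_diagonal.
  by apply/seteqP; split.
apply: measurableT_comp => //; apply: measurable_funB.
  exact: (measurableT_comp mf measurable_fst).
exact: (measurableT_comp mf measurable_snd).
Qed.

Variable mu : {sigma_finite_measure set X -> \bar R}.

Definition oscillation f r : \bar R :=
  (\int[mu]_x \int[mu]_y (local_diff f r (x, y))%:E)%E.

Lemma oscillation_ge0 f r : (0 <= oscillation f r)%E.
Proof.
by do 2 (apply: integral_ge0 => ? _); rewrite lee_fin local_diff_ge0.
Qed.

Hypothesis prop : proper_metric X.

Lemma measurable_local_diff2 f r x : measurable_fun setT f ->
  measurable_fun setT (fun y => (local_diff f r (x, y))%:E).
Proof.
by move=> mf; exact: (measurable_fun_pair2 x (measurable_local_diff r prop mf)).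
Qed.

Lemma measurable_integral_local_diff f r : measurable_fun setT f ->
  measurable_fun setT (fun x => \int[mu]_y (local_diff f r (x, y))%:E)%E.
Proof.
move=> mf; apply: (measurable_fun_fubini_tonelli_F (fun z => (local_diff f r z)%:E)).
  exact: measurable_local_diff.
by move=> z; rewrite lee_fin local_diff_ge0.
Qed.

Lemma oscillationZ f r (k : R) : 0 <= k -> measurable_fun setT f ->
  (\int[mu]_x \int[mu]_y (k * local_diff f r (x, y))%:E = k%:E * oscillation f r)%E.
Proof.
move=> k0 mf; rewrite /oscillation -ge0_integralZl_EFin//; last 2 first.
- by move=> x _; apply: integral_ge0 => y _; rewrite lee_fin local_diff_ge0.
- exact: measurable_integral_local_diff.
apply: eq_integral => x _; rewrite -ge0_integralZl_EFin//.
- by move=> y _; rewrite lee_fin local_diff_ge0.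
- exact: measurable_local_diff2.
Qed.

(** In [`|f x - f y| <= `|f x| + `|f y|], each term is integrated first in the
    variable on which it does not depend, which yields the volume of a ball. *)
Lemma oscillation_le_norm f (r M : R) : mu.-integrable setT (EFin \o f) ->
  (forall x, (mu (ball x r) <= M%:E)%E) -> 0 <= M ->
  (oscillation f r <= M%:E * \int[mu]_x `|f x|%:E + M%:E * \int[mu]_x `|f x|%:E)%E.
Proof.
move=> fi bM M0.
have mf : measurable_fun setT f by exact/measurable_EFinP/(measurable_int mu fi).
have mnf : measurable_fun setT (fun x => `|f x|%:E).
  by apply/measurable_EFinP; exact: measurableT_comp.
pose D := [set z : X * X | mdist z.1 z.2 < r].
have mD : measurable D by exact: measurable_near_diagonal.
pose g1 (z : X * X) := (`|f z.1| * \1_D z)%:E.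
pose g2 (z : X * X) := (`|f z.2| * \1_D z)%:E.
have m1 : measurable_fun setT g1.
  apply/measurable_EFinP/measurable_funM; last exact: measurable_indic.
  apply: measurableT_comp => //.
  exact: (measurableT_comp mf measurable_fst).
have m2 : measurable_fun setT g2.
  apply/measurable_EFinP/measurable_funM; last exact: measurable_indic.
  apply: measurableT_comp => //.
  exact: (measurableT_comp mf measurable_snd).
have p1 z : (0 <= g1 z)%E by rewrite lee_fin mulr_ge0.
have p2 z : (0 <= g2 z)%E by rewrite lee_fin mulr_ge0.
have D1 x : (\int[mu]_y (\1_D (x, y))%:E = mu (ball x r))%E.
  rewrite -(setIT (ball x r)) -integral_indic//; last exact: ball_measurable.
  apply: eq_integral => y _; rewrite !indicE; congr (_%:R%:E); congr nat_of_bool.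
  by apply/idP/idP; rewrite !inE ballEmdist.
have D2 y : (\int[mu]_x (\1_D (x, y))%:E = mu (ball y r))%E.
  rewrite -D1; apply: eq_integral => x _; rewrite !indicE; congr (_%:R%:E); congr nat_of_bool.
  by apply/idP/idP; rewrite !inE /D /= metric_sym.
have mindic : measurable_fun setT (fun z => (\1_D z)%:E : \bar R).
  by apply/measurable_EFinP; exact: measurable_indic.
have bnd (h : X -> \bar R) : (forall x, h x <= mu (ball x r))%E -> (forall x, 0 <= h x)%E ->
    (\int[mu]_x (`|f x|%:E * h x) <= M%:E * \int[mu]_x `|f x|%:E)%E.
  move=> hm h0; rewrite -ge0_integralZl_EFin//.
  apply: ge0_le_integralW => x _; first by rewrite mule_ge0.
  rewrite muleC; apply: lee_wpmul2r => //; exact: le_trans (bM x).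
apply: (@le_trans _ _ (\int[mu]_x \int[mu]_y g1 (x, y) +
                       \int[mu]_x \int[mu]_y g2 (x, y))%E).
  rewrite -ge0_integralD//; last 4 first.
  - by move=> x _; exact: integral_ge0.
  - exact: (measurable_fun_fubini_tonelli_F g1 m1 p1).
  - by move=> x _; exact: integral_ge0.
  - exact: (measurable_fun_fubini_tonelli_F g2 m2 p2).
  apply: ge0_le_integralW => x _.
    by apply: integral_ge0 => y _; rewrite lee_fin local_diff_ge0.
  rewrite -ge0_integralD//; last 2 first.
  - exact: (measurable_fun_pair2 x m1).
  - exact: (measurable_fun_pair2 x m2).
  apply: ge0_le_integralW => y _; first by rewrite lee_fin local_diff_ge0.
  rewrite -EFinD lee_fin -mulrDl /local_diff indicE /=.
  have -> : ((x, y) \in D) = (mdist x y < r) by apply/idP/idP; rewrite inE.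
  by case: ifP => _; rewrite ?mulr1 ?mulr0// ler_normB.
apply: leeD.
  under eq_integral => x _.
    under eq_integral do rewrite /g1 EFinM /=.
    rewrite ge0_integralZl_EFin//=; last 1 first.
      exact: (measurable_fun_pair2 x mindic).
    over.
  apply: bnd => x; last by apply: integral_ge0 => y _; rewrite lee_fin.
  by rewrite D1.
rewrite (fubini_tonelli g2 m2 p2)//.
under eq_integral => y _.
  under eq_integral do rewrite /g2 EFinM /=.
  rewrite ge0_integralZl_EFin//=; last 1 first.
    exact: (measurable_fun_pair1 y mindic).
  over.
apply: bnd => y; last by apply: integral_ge0 => x _; rewrite lee_fin.
by rewrite D2.
Qed.

End oscillation.

(** * Dyadic summation of the oscillations *)

Section dyadic.
Context {R : realType}.
Implicit Types a b r s z : R.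

Lemma nneseries_geometric_lty a z : 0 <= a -> 0 < z < 1 ->
  (\sum_(0 <= j <oo) (a * z ^+ j)%:E < +oo)%E.
Proof.
move=> a0 /andP[z0 z1]; apply: (@le_lt_trans _ _ (a * (1 - z)^-1)%:E); last exact: ltry.
apply: lime_le.
  by apply: is_cvg_nneseries => n _ _; rewrite lee_fin mulr_ge0 ?exprn_ge0// ltW.
apply: nearW => n; rewrite sumEFin lee_fin.
have := @geometric_le_lim _ n a z a0 z0; rewrite ger0_norm ?(ltW z0)// => /(_ z1).
by rewrite /series/=.
Qed.

Lemma dyadic_shell_le r s : 0 < s -> s < r ->
  exists j : nat, r * 2^-1 ^+ j.+1 <= s < r * 2^-1 ^+ j.
Proof.
move=> s0 sr; have r0 : 0 < r by exact: lt_trans sr.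
have ex : exists n : nat, r * 2^-1 ^+ n <= s.
  pose n := (Num.truncn (r / s)).+1; exists n; rewrite exprVn ler_pdivrMr ?exprn_gt0//.
  have h1 : r / s < n%:R by exact: truncnS_gt.
  have h2 : (n%:R : R) <= 2 ^+ n by rewrite -natrX ler_nat ltnW// ltn_expl.
  by rewrite -ler_pdivrMl// mulrC ltW// (lt_le_trans h1).
case: (ex_minnP ex) => -[|j] h1 h2; first by move: h1; rewrite expr0 mulr1 leNgt sr.
exists j; rewrite h1 ltNge; apply/negP => h; have := h2 _ h; by rewrite ltnn.
Qed.

Lemma dyadic_shell_ge r s : 0 < r -> r <= s ->
  exists j : nat, r * 2 ^+ j <= s < r * 2 ^+ j.+1.
Proof.
move=> r0 rs.
have ex : exists n : nat, s < r * 2 ^+ n.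
  pose n := (Num.truncn (s / r)).+1; exists n.
  have h1 : s / r < n%:R by exact: truncnS_gt.
  have h2 : (n%:R : R) <= 2 ^+ n by rewrite -natrX ler_nat ltnW// ltn_expl.
  by rewrite -ltr_pdivrMl// mulrC (lt_le_trans h1).
case: (ex_minnP ex) => -[|j] h1 h2; first by move: h1; rewrite expr0 mulr1 ltNge rs.
exists j; rewrite h1 andbT leNgt; apply/negP => h; have := h2 _ h; by rewrite ltnn.
Qed.

Lemma powR_exprn a b (n : nat) : 0 <= a -> (a ^+ n) `^ b = (a `^ b) ^+ n.
Proof.
by move=> a0; rewrite -powR_mulrn// -powRrM mulrC powRrM powR_mulrn// powR_ge0.
Qed.

End dyadic.

Section energy.
Context (R : realType) (d : measure_display) (X : borelMetricType R d).
Variable mu : {sigma_finite_measure set X -> \bar R}.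
Hypothesis prop : proper_metric X.
Implicit Types (f : X -> R) (x y : X).

(** Split according to dyadic annuli of [mdist x y]. The annulus of radius [r]
    contributes at most a constant times [r `^ (- (dH + sg))] times the
    oscillation at scale [r]: this is [O(r `^ (lam - sg))] for small [r] and
    [O(r `^ (- sg))] for large [r], and both sum up as geometric series. *)
Lemma fractional_energy_lty f (dH sg lam M A r0 : R) :
  measurable_fun setT f -> 0 <= M -> 0 <= A -> 0 < r0 -> 0 < dH -> 0 < sg -> sg < lam ->
  (forall r, 0 < r -> r < r0 -> (oscillation mu f r <= (M * r `^ (dH + lam))%:E)%E) ->
  (forall r, 0 < r -> (oscillation mu f r <= (A * r `^ dH)%:E)%E) ->
  (\int[mu]_x \int[mu]_y (`|f x - f y| * mdist x y `^ (- (dH + sg)))%:E < +oo)%E.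
Proof.
move=> mf M0 A0 r00 dH0 sg0 sglam Hn Hf.
pose r1 := r0 / 2; have r10 : 0 < r1 by rewrite divr_gt0.
pose q := dH + sg; have q0 : 0 < q by rewrite addr_gt0.
(* [u j] majorizes the integrand where [r1 / 2 ^ j.+1 <= mdist < r1 / 2 ^ j], and
   [v j] where [r1 * 2 ^ j <= mdist < r1 * 2 ^ j.+1]. *)
pose a (j : nat) := (r1 * 2^-1 ^+ j.+1) `^ (- q).
pose b (j : nat) := (r1 * 2 ^+ j) `^ (- q).
pose u (j : nat) z := a j * local_diff f (r1 * 2^-1 ^+ j) z.
pose v (j : nat) z := b j * local_diff f (r1 * 2 ^+ j.+1) z.
pose h (j : nat) (z : X * X) := ((u j z)%:E + (v j z)%:E)%E.
have a0 j : 0 <= a j by exact: powR_ge0.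
have b0 j : 0 <= b j by exact: powR_ge0.
have u0 j z : (0 <= (u j z)%:E)%E by rewrite lee_fin mulr_ge0 ?local_diff_ge0.
have v0 j z : (0 <= (v j z)%:E)%E by rewrite lee_fin mulr_ge0 ?local_diff_ge0.
have h0 j z : (0 <= h j z)%E by rewrite adde_ge0.
have mu_ j : measurable_fun setT (fun z => (u j z)%:E).
  under eq_fun do rewrite EFinM; apply: measurable_funeM; exact: measurable_local_diff.
have mv j : measurable_fun setT (fun z => (v j z)%:E).
  under eq_fun do rewrite EFinM; apply: measurable_funeM; exact: measurable_local_diff.
have mh j : measurable_fun setT (h j) by exact: emeasurable_funD.
have pw x y : ((`|f x - f y| * mdist x y `^ (- (dH + sg)))%:E
    <= \sum_(0 <= j <oo) h j (x, y))%E.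
  suff [j hj] : exists j, ((`|f x - f y| * mdist x y `^ (- (dH + sg)))%:E <= h j (x, y))%E.
    apply: (le_trans hj); apply: le_trans (nneseries_lim_ge j.+1 _) => [|k _ _//].
    by rewrite big_nat_recr//= leeDr// sume_ge0.
  have [<-|xy] := eqVneq x y.
    by exists 0%N; rewrite subrr normr0 mul0r.
  have D0 : 0 < mdist x y by rewrite mdist_gt0.
  have dec (s : R) : 0 < s -> s <= mdist x y -> mdist x y `^ (- q) <= s `^ (- q).
    move=> s0 sD; rewrite !powRN lef_pV2 ?posrE ?powR_gt0//.
    by apply: (ge0_ler_powR (ltW q0)) => //; rewrite nnegrE ltW.
  have [Dr|rD] := ltP (mdist x y) r1.
    have [j /andP[j1 j2]] := dyadic_shell_le D0 Dr; exists j.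
    apply: (@le_trans _ _ (u j (x, y))%:E); last by rewrite leeDl.
    rewrite lee_fin /u /local_diff /= j2 mulrC ler_wpM2r// dec//.
    by rewrite mulr_gt0// exprn_gt0// invr_gt0.
  have [j /andP[j1 j2]] := dyadic_shell_ge r10 rD; exists j.
  apply: (@le_trans _ _ (v j (x, y))%:E); last by rewrite leeDr.
  rewrite lee_fin /v /local_diff /= j2 mulrC ler_wpM2r// dec//.
  by rewrite mulr_gt0// exprn_gt0.
apply: (@le_lt_trans _ _ (\int[mu]_x \int[mu]_y \sum_(0 <= j <oo) h j (x, y))%E).
  apply: ge0_le_integralW => x _.
    by apply: integral_ge0 => y _; rewrite lee_fin mulr_ge0 ?powR_ge0.
  by apply: ge0_le_integralW => y _ //; rewrite lee_fin mulr_ge0 ?powR_ge0.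
under eq_integral => x _.
  rewrite integral_nneseries//; last by move=> j; exact: measurable_fun_pair2.
  over.
rewrite integral_nneseries//; last 2 first.
- by move=> j; apply: (measurable_fun_fubini_tonelli_F (h j)).
- by move=> j x _; exact: integral_ge0.
have hE j : (\int[mu]_x \int[mu]_y h j (x, y) =
    (a j)%:E * oscillation mu f (r1 * 2^-1 ^+ j) +
    (b j)%:E * oscillation mu f (r1 * 2 ^+ j.+1))%E.
  rewrite -!oscillationZ// -ge0_integralD//; last 4 first.
  - by move=> x _; apply: integral_ge0 => y _; exact: u0.
  - exact: (measurable_fun_fubini_tonelli_F _ (mu_ j) (u0 j)).
  - by move=> x _; apply: integral_ge0 => y _; exact: v0.
  - exact: (measurable_fun_fubini_tonelli_F _ (mv j) (v0 j)).
  apply: eq_integral => x _; rewrite -ge0_integralD//.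
  - by move=> y _; exact: u0.
  - exact: (measurable_fun_pair2 x (mu_ j)).
  - by move=> y _; exact: v0.
  - exact: (measurable_fun_pair2 x (mv j)).
pose z1 : R := 2^-1 `^ (lam - sg).
pose z2 : R := 2^-1 `^ sg.
have half (e : R) : 0 < e -> 0 < (2^-1 : R) `^ e < 1.
  move=> e0; rewrite powR_gt0//=.
  have := gt0_ltr_powR e0; move=> /(_ (2^-1) 1); rewrite !nnegrE powR1; apply => //; lra.
have /andP[z10 z11] : 0 < z1 < 1 by apply: half; rewrite subr_gt0.
have /andP[z20 z21] : 0 < z2 < 1 by exact: half.
pose C1 := M * 2 `^ q * r1 `^ (lam - sg).
pose C2 := A * 2 `^ dH * r1 `^ (- sg).
have C10 : 0 <= C1 by rewrite !mulr_ge0 ?powR_ge0.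
have C20 : 0 <= C2 by rewrite !mulr_ge0 ?powR_ge0.
have e1 j : ((a j)%:E * oscillation mu f (r1 * 2^-1 ^+ j) <= (C1 * z1 ^+ j)%:E)%E.
  set r := r1 * 2^-1 ^+ j.
  have rp : 0 < r by rewrite mulr_gt0 ?exprn_gt0 ?invr_gt0.
  have rr0 : r < r0.
    apply: (@le_lt_trans _ _ r1); last by rewrite /r1; lra.
    by rewrite ler_piMr ?(ltW r10)// exprn_ile1//; lra.
  apply: (@le_trans _ _ ((a j)%:E * (M * r `^ (dH + lam))%:E)%E).
    by apply: lee_wpmul2l; [rewrite lee_fin|exact: Hn].
  rewrite -EFinM lee_fin le_eqVlt; apply/orP; left; apply/eqP.
  have -> : a j = r `^ (- q) * 2 `^ q.
    rewrite /a exprSr mulrA -/r powRM ?invr_ge0 ?(ltW rp)//.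
    by rewrite powR_inv// opprK.
  have -> : C1 * z1 ^+ j = M * 2 `^ q * r `^ (lam - sg).
    rewrite /C1 /r powRM ?exprn_ge0 ?(ltW r10) ?invr_ge0// powR_exprn ?invr_ge0//.
    by rewrite -/z1 -mulrA.
  rewrite (_ : lam - sg = - q + (dH + lam)); last by rewrite /q; ring.
  by rewrite (@powRD _ r (- q)) ?(gt_eqF rp) ?implybT//; ring.
have e2 j : ((b j)%:E * oscillation mu f (r1 * 2 ^+ j.+1) <= (C2 * z2 ^+ j)%:E)%E.
  set r := r1 * 2 ^+ j.
  have rp : 0 < r by rewrite mulr_gt0 ?exprn_gt0.
  have -> : r1 * 2 ^+ j.+1 = r * 2 by rewrite exprSr mulrA.
  apply: (@le_trans _ _ ((b j)%:E * (A * (r * 2) `^ dH)%:E)%E).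
    by apply: lee_wpmul2l; [rewrite lee_fin|apply: Hf; rewrite mulr_gt0].
  rewrite -EFinM lee_fin le_eqVlt; apply/orP; left; apply/eqP.
  have -> : C2 * z2 ^+ j = A * 2 `^ dH * r `^ (- sg).
    rewrite /C2 /r powRM ?exprn_ge0 ?(ltW r10)// powR_exprn//.
    by rewrite -(@powR_inv _ 2 sg)// -/z2 -[RHS]mulrA mulrA -!mulrA.
  rewrite (_ : - sg = - q + dH); last by rewrite /q; ring.
  by rewrite (@powRD _ r (- q)) ?(gt_eqF rp) ?implybT// powRM ?(ltW rp)// /b -/r; ring.
apply: (@le_lt_trans _ _ (\sum_(0 <= j <oo) ((C1 * z1 ^+ j)%:E + (C2 * z2 ^+ j)%:E))%E).
  apply: lee_nneseries => j; first by move=> *; do 2 (apply: integral_ge0 => ? _).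
  by move=> _; rewrite hE; apply: leeD.
rewrite nneseriesD; last 2 first.
- by move=> j _; rewrite lee_fin mulr_ge0 ?exprn_ge0// ltW.
- by move=> j _; rewrite lee_fin mulr_ge0 ?exprn_ge0// ltW.
by apply: lte_add_pinfty; apply: nneseries_geometric_lty => //; apply/andP.
Qed.

End energy.

(** * Korevaar-Schoen and Besov classes in terms of oscillations *)

Section function_classes.
Context (R : realType) (d : measure_display) (X : borelMetricType R d).
Variable mu : {sigma_finite_measure set X -> \bar R}.
Hypothesis prop : proper_metric X.
Implicit Types (f : X -> R) (x y : X).

Lemma measurable_mdist : measurable_fun setT (fun z : X * X => mdist z.1 z.2 : R).
Proof.
move=> mT; apply: (measurability _ (RGenInftyO.measurableE R)) => //.
move=> _ [_ [r ->] <-]; rewrite setTI.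
rewrite (_ : _ @^-1` _ = [set z : X * X | mdist z.1 z.2 < r]).
  exact: measurable_near_diagonal.
by apply/seteqP; split => z /=; rewrite in_itv/=.
Qed.

Lemma lty_EFin_ub (v : \bar R) : (v < +oo)%E -> exists2 M, 0 <= M & (v <= M%:E)%E.
Proof.
case: v => [r _||_]; last by exists 0; rewrite ?leNye.
  by exists `|r|; rewrite // lee_fin ler_norm.
by rewrite ltxx.
Qed.

Lemma Lfun1_measurable f : f \in Lfun mu 1 -> measurable_fun setT f.
Proof. by move=> /Lfun1_integrable fi; exact/measurable_EFinP/(measurable_int mu fi). Qed.

Section volume_growth.
Variables (dH c1 c2 : R).
Hypotheses (c10 : 0 < c1) (c20 : 0 < c2) (volume : forall x r, 0 <= r ->
  ((c1 * r `^ dH)%:E <= mu (ball x r) <= (c2 * r `^ dH)%:E)%E).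

Let ks_integral lam f r : \bar R := (\int[mu]_x \int[mu]_(y in ball x r)
  ((`|f x - f y| `^ 1 / r `^ (lam * 1))%:E * (mu (ball x r))^-1))%E.

(* The constants [c1] and [c2] turn the factor [(mu (ball x r))^-1], which varies
   with [x], into the power [r `^ (- dH)]. *)
Let volume_inv x r : 0 < r ->
  exists b : R, [/\ ((mu (ball x r))^-1 = b%:E)%E,
    (c2 * r `^ dH)^-1 <= b & b <= (c1 * r `^ dH)^-1].
Proof.
move=> r0; have /andP[] := volume x (ltW r0).
have p1 : 0 < c1 * r `^ dH by rewrite mulr_gt0 ?powR_gt0.
have p2 : 0 < c2 * r `^ dH by rewrite mulr_gt0 ?powR_gt0.
case: (mu (ball x r)) => [m||] //; rewrite !lee_fin => h1 h2.
have m0 : 0 < m by exact: lt_le_trans h1.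
by exists m^-1; rewrite inver gt_eqF// !lef_pV2 ?posrE.
Qed.

Let ks_integral_ge lam f r : measurable_fun setT f -> 0 < r ->
  (((c2 * r `^ dH)^-1 * (r `^ lam)^-1)%:E * oscillation mu f r <= ks_integral lam f r)%E.
Proof.
move=> mf r0; rewrite -oscillationZ//; last first.
  by rewrite mulr_ge0// ?invr_ge0 ?mulr_ge0 ?powR_ge0// ltW.
apply: ge0_le_integralW => x _.
  apply: integral_ge0 => y _; rewrite lee_fin mulr_ge0 ?local_diff_ge0//.
  by rewrite mulr_ge0// ?invr_ge0 ?mulr_ge0 ?powR_ge0// ltW.
rewrite [leRHS]integral_mkcond; apply: ge0_le_integralW => y _.
  rewrite lee_fin mulr_ge0 ?local_diff_ge0//.
  by rewrite mulr_ge0// ?invr_ge0 ?mulr_ge0 ?powR_ge0// ltW.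
rewrite patchE /local_diff /=.
have -> : (y \in (ball x r : set X)) = (mdist x y < r).
  by rewrite ballEmdist; apply/idP/idP; rewrite inE.
case: ifP => _; last by rewrite mulr0.
have [b [-> b2 _]] := volume_inv x r0.
rewrite -EFinM lee_fin powRr1// mulr1 mulrC mulrCA mulrC.
by apply: ler_wpM2l => //; rewrite divr_ge0 ?powR_ge0.
Qed.

Let ks_integral_le lam f r : measurable_fun setT f -> 0 < r ->
  (ks_integral lam f r <= ((c1 * r `^ dH)^-1 * (r `^ lam)^-1)%:E * oscillation mu f r)%E.
Proof.
move=> mf r0; rewrite -oscillationZ//; last first.
  by rewrite mulr_ge0// ?invr_ge0 ?mulr_ge0 ?powR_ge0// ltW.
have pos x y : (0 <= (`|f x - f y| `^ 1 / r `^ (lam * 1))%:E * (mu (ball x r))^-1)%E.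
  have [b [-> b2 _]] := volume_inv x r0.
  rewrite -EFinM lee_fin !mulr_ge0 ?invr_ge0 ?powR_ge0//.
  by apply: le_trans b2; rewrite invr_ge0 mulr_ge0 ?powR_ge0// ltW.
apply: ge0_le_integralW => x _; first exact: integral_ge0.
rewrite integral_mkcond; apply: ge0_le_integralW => y _.
  by apply: erestrict_ge0.
rewrite patchE /local_diff /=.
have -> : (y \in (ball x r : set X)) = (mdist x y < r).
  by rewrite ballEmdist; apply/idP/idP; rewrite inE.
case: ifP => _; last by rewrite mulr0.
have [b [-> _ b1]] := volume_inv x r0.
rewrite -EFinM lee_fin powRr1// mulr1 [leRHS]mulrC [leRHS]mulrCA [leRHS]mulrC.
by apply: ler_wpM2l => //; rewrite divr_ge0 ?powR_ge0.
Qed.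

Lemma korevaar_schoen_oscillation lam f : korevaar_schoen mu lam 1 f ->
  exists M r0, [/\ 0 <= M, 0 < r0 & forall r, 0 < r -> r < r0 ->
    (oscillation mu f r <= (M * r `^ (dH + lam))%:E)%E].
Proof.
move=> [fL]; have mf := Lfun1_measurable fL.
rewrite limf_esupE => /ereal_inf_lt[_ [V [/= r0 r00 rV] <-]] /lty_EFin_ub[M M0 VM].
exists (c2 * M), r0; split => //; first by rewrite mulr_ge0// ltW.
move=> r rp rr0.
have k0 : 0 < (c2 * r `^ dH)^-1 * (r `^ lam)^-1.
  by rewrite mulr_gt0 ?invr_gt0 ?mulr_gt0 ?powR_gt0.
rewrite -(@lee_pmul2l _ ((c2 * r `^ dH)^-1 * (r `^ lam)^-1)%:E) ?lte_fin//.
apply: (le_trans (ks_integral_ge lam mf rp)).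
apply: (@le_trans _ _ M%:E).
  apply: le_trans VM; apply: ereal_sup_ubound; exists r => //.
  by apply: rV => //=; rewrite sub0r normrN ger0_norm// ltW.
rewrite -EFinM lee_fin powRD ?(gt_eqF rp) ?implybT// le_eqVlt; apply/orP; left.
by apply/eqP; field; rewrite !gt_eqF ?powR_gt0.
Qed.

Lemma oscillation_korevaar_schoen lam f (M r0 : R) : f \in Lfun mu 1 -> 0 < r0 ->
  (forall r, 0 < r -> r < r0 -> (oscillation mu f r <= (M * r `^ (dH + lam))%:E)%E) ->
  korevaar_schoen mu lam 1 f.
Proof.
move=> fL r00 H; split => //; have mf := Lfun1_measurable fL.
rewrite limf_esupE; apply: (@le_lt_trans _ _ (M / c1)%:E); last exact: ltry.
apply: (@le_trans _ _ (ereal_sup (ks_integral lam f @` [set r | 0 < r < r0]))).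
  apply: ereal_inf_lbound; exists [set r | 0 < r < r0] => //.
  exists r0 => //= r /=; rewrite sub0r normrN => h rp; rewrite rp/=.
  by rewrite (le_lt_trans (ler_norm _) h).
apply: ge_ereal_sup => _ [r /andP[rp rr0] <-].
have k0 : 0 < (c1 * r `^ dH)^-1 * (r `^ lam)^-1.
  by rewrite mulr_gt0 ?invr_gt0 ?mulr_gt0 ?powR_gt0.
apply: (le_trans (ks_integral_le lam mf rp)).
apply: (@le_trans _ _ (((c1 * r `^ dH)^-1 * (r `^ lam)^-1)%:E * (M * r `^ (dH + lam))%:E)%E).
  by rewrite lee_pmul2l ?lte_fin//; exact: H.
rewrite -EFinM lee_fin powRD ?(gt_eqF rp) ?implybT// le_eqVlt; apply/orP; left.
by apply/eqP; field; rewrite !gt_eqF ?powR_gt0.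
Qed.

End volume_growth.

(** The kernel is at least [k * t * rho `^ (- (dH + delta * dW))] on the pairs that
    count for the oscillation at scale [rho], so the latter is controlled by the
    double integral of the seminorm at time [t], which is [O(t `^ al)]. The times
    [t] below [rho `^ (delta * dW)] are all kept: the largest one is best for
    [al <= 1], and small ones for [1 < al]. *)
Lemma besov_oscillation (K : R -> X -> X -> \bar R) (k dH delta dW al : R) f :
  0 < k -> (forall t x y, 0 < t -> (0 <= K t x y)%E) ->
  (forall t rho x y, 0 < t -> 0 < rho -> mdist x y <= rho -> t <= rho `^ (delta * dW) ->
    ((k * t * rho `^ (- (dH + delta * dW)))%:E <= K t x y)%E) ->
  besov_class mu K 1 al f ->
  exists2 M, 0 <= M & forall t rho, 0 < t -> 0 < rho -> t <= rho `^ (delta * dW) ->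
    (oscillation mu f rho <= (M * t `^ (al - 1) * rho `^ (dH + delta * dW))%:E)%E.
Proof.
move=> k0 K0 Kge [fL /lty_EFin_ub[M M0 SM]].
have mf := Lfun1_measurable fL.
exists (M / k); first by rewrite divr_ge0// ltW.
move=> t rho t0 rho0 trho.
pose I := (\int[mu]_y \int[mu]_x ((`|f x - f y| `^ 1)%:E * K t x y))%E.
have I0 : (0 <= I)%E.
  by do 2 (apply: integral_ge0 => ? _); rewrite mule_ge0 ?K0// lee_fin powR_ge0.
have IM : ((t `^ (- al))%:E * I <= M%:E)%E.
  apply: le_trans SM; apply: ereal_sup_ubound; exists t; first by rewrite /= in_itv/= andbT.
  by rewrite invr1 poweRe1.
have kp : 0 < k * t * rho `^ (- (dH + delta * dW)) by rewrite !mulr_gt0 ?powR_gt0.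
have le1 : ((k * t * rho `^ (- (dH + delta * dW)))%:E * oscillation mu f rho <= I)%E.
  rewrite -oscillationZ ?(ltW kp)//; apply: ge0_le_integralW => x _.
    by apply: integral_ge0 => y _; rewrite lee_fin mulr_ge0 ?local_diff_ge0// ltW.
  apply: ge0_le_integralW => y _.
    by rewrite lee_fin mulr_ge0 ?local_diff_ge0// ltW.
  rewrite /local_diff /= powRr1// distrC; case: ifP => [xy|_]; last first.
    by rewrite mulr0 mule_ge0 ?K0.
  rewrite mulrC EFinM; apply: lee_wpmul2l; first by rewrite lee_fin.
  by apply: Kge => //; rewrite metric_sym ltW.
have tp : 0 < t `^ (- al) by rewrite powR_gt0.
rewrite -(@lee_pmul2l _ (t `^ (- al) * (k * t * rho `^ (- (dH + delta * dW))))%:E)//; last first.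
  by rewrite lte_fin mulr_gt0.
rewrite EFinM -muleA; apply: (@le_trans _ _ ((t `^ (- al))%:E * I)%E).
  by rewrite lee_pmul2l// lte_fin.
apply: (le_trans IM); rewrite -!EFinM lee_fin le_eqVlt; apply/orP; left; apply/eqP.
rewrite !powRN powRB ?(gt_eqF t0) ?implybT// powRr1 ?(ltW t0)//.
by field; rewrite !gt_eqF ?powR_gt0.
Qed.

Lemma oscillation_besov (K : R -> X -> X -> \bar R) (C al q : R) f :
  f \in Lfun mu 1 -> 0 <= C -> (forall t x y, 0 < t -> (0 <= K t x y)%E) ->
  (forall t x y, 0 < t -> x != y ->
    (K t x y <= (C * t `^ al * mdist x y `^ (- q))%:E)%E) ->
  (\int[mu]_x \int[mu]_y (`|f x - f y| * mdist x y `^ (- q))%:E < +oo)%E ->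
  besov_class mu K 1 al f.
Proof.
move=> fL C0 K0 Kle; set W := (X in (X < _)%E) => Wlt.
have mf := Lfun1_measurable fL; split => //.
have W0 : (0 <= W)%E.
  by do 2 (apply: integral_ge0 => ? _); rewrite lee_fin mulr_ge0 ?powR_ge0.
apply: (@le_lt_trans _ _ (C%:E * W)%E); last first.
  by rewrite lte_mul_pinfty ?lee_fin.
apply: ge_ereal_sup => v [t /=]; rewrite in_itv/= andbT => t0 <- {v}.
rewrite invr1 poweRe1; last first.
  by do 2 (apply: integral_ge0 => ? _); rewrite mule_ge0 ?K0// lee_fin powR_ge0.
have tp : 0 < t `^ al by rewrite powR_gt0.
rewrite powRN -(@lee_pmul2l _ (t `^ al)%:E)//.
rewrite muleA -EFinM mulfV ?gt_eqF// mul1e muleA -EFinM mulrC.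
pose g (z : X * X) := (`|f z.1 - f z.2| * mdist z.1 z.2 `^ (- q))%:E.
have g0 z : (0 <= g z)%E by rewrite lee_fin mulr_ge0 ?powR_ge0.
have mg : measurable_fun setT g.
  apply/measurable_EFinP/measurable_funM.
    apply: measurableT_comp => //; apply: measurable_funB.
      exact: (measurableT_comp mf measurable_fst).
    exact: (measurableT_comp mf measurable_snd).
  exact: (measurableT_comp (measurable_powR (- q)) measurable_mdist).
have Ct0 : 0 <= C * t `^ al by rewrite mulr_ge0 ?powR_ge0.
apply: (@le_trans _ _ (\int[mu]_x \int[mu]_y ((C * t `^ al)%:E * g (x, y)))%E); last first.
  under eq_integral => x _.
    rewrite ge0_integralZl_EFin//; last exact: (measurable_fun_pair2 x mg).
    over.
  rewrite ge0_integralZl_EFin//.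
    by move=> x _; exact: integral_ge0.
  exact: (measurable_fun_fubini_tonelli_F g mg g0).
apply: ge0_le_integralW => x _.
  by apply: integral_ge0 => y _; rewrite mule_ge0 ?K0// lee_fin powR_ge0.
apply: ge0_le_integralW => y _; first by rewrite mule_ge0 ?K0// lee_fin powR_ge0.
rewrite powRr1// /g /=; have [->|xy] := eqVneq x y.
  by rewrite subrr normr0 mul0e mul0r mule0.
rewrite distrC [leRHS]muleC EFinM -muleA; apply: lee_wpmul2l; first by rewrite lee_fin.
by rewrite -EFinM mulrC metric_sym; apply: Kle => //; rewrite eq_sym.
Qed.

(** For almost every [x], [f] agrees with [f x] almost everywhere on each ball of
    integer radius around [x]; one such [x] is enough. *)
Lemma oscillation0_constant f : full_support mu -> measurable_fun setT f ->
  (forall r, 0 < r -> oscillation mu f r = 0%E) -> ~ nonconstant mu f.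
Proof.
move=> fs mf osc0; apply; have [[x0 _]|X0] := pselect (exists x : X, True); last first.
  by exists 0; apply: aeW => x; exfalso; apply: X0; exists x.
have loc_ge0 n x y : (0 <= (local_diff f n.+1%:R (x, y))%:E)%E.
  by rewrite lee_fin local_diff_ge0.
have ae0 : {ae mu, forall x, forall n : nat,
    (\int[mu]_y (local_diff f n.+1%:R (x, y))%:E = 0)%E}.
  apply/ae_foralln => n.
  have mF := @measurable_integral_local_diff _ _ _ mu prop f n.+1%:R mf.
  have := (ae_eq_integral_abs mu measurableT mF).1.
  have -> : (\int[mu]_x `|\int[mu]_y (local_diff f n.+1%:R (x, y))%:E| = 0)%E.
    rewrite -(osc0 n.+1%:R)//; apply: eq_integral => x _.
    by rewrite gee0_abs//; apply: integral_ge0.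
  by move=> /(_ erefl); apply: filterS => x /(_ I).
have [x xP] : exists x, forall n : nat,
    (\int[mu]_y (local_diff f n.+1%:R (x, y))%:E = 0)%E.
  apply: contrapT => nex.
  have muT0 : (0 < mu setT)%E by apply: fs; [exact: openT|exists x0].
  have [N [mN N0 sN]] := ae0.
  have : (mu setT <= mu N)%E.
    apply: le_measure; rewrite ?inE// => z _; apply: sN => /= h; apply: nex.
    by exists z.
  by rewrite N0 leNgt muT0.
exists (f x).
have : {ae mu, forall y, forall n : nat, (local_diff f n.+1%:R (x, y))%:E = 0%E}.
  apply/ae_foralln => n.
  have mF := @measurable_local_diff2 _ _ _ prop f n.+1%:R x mf.
  have := (ae_eq_integral_abs mu measurableT mF).1.
  have -> : (\int[mu]_y `|(local_diff f n.+1%:R (x, y))%:E| = 0)%E.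
    by rewrite -(xP n); apply: eq_integral => y _; rewrite gee0_abs.
  by move=> /(_ erefl); apply: filterS => y /(_ I).
apply: filterS => y + _; move=> /(_ (Num.truncn (mdist x y))).
rewrite /local_diff /= truncnS_gt => -[] /eqP.
by rewrite normr_eq0 subr_eq0 => /eqP.
Qed.

End function_classes.

(** * The Besov exponent *)

Lemma ereal_sup_ge_interval (R : realType) (A : set R) (B : R) : 0 < B ->
  (forall al, 0 < al -> al < B -> A al) ->
  (B%:E <= ereal_sup [set al%:E | al in A])%E.
Proof.
move=> B0 H; apply/lee_addgt0Pr => e e0.
pose al := Num.max (B / 2) (B - e).
have Aal : A al.
  apply: H; first by rewrite lt_max divr_gt0.
  by rewrite gt_max; apply/andP; split; lra.
apply: (@le_trans _ _ (al%:E + e%:E)%E).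
  have : B - e <= al by rewrite le_max lexx orbT.
  by rewrite -EFinD lee_fin; lra.
by rewrite leeD2r//; apply: ereal_sup_ubound; exists al.
Qed.

Section besov_exponent_bounds.
Context (R : realType) (d : measure_display) (X : borelMetricType R d).
Variables (mu : {sigma_finite_measure set X -> \bar R}) (p : R -> X -> X -> R).
Variables (dH dW delta : R) (eta : R -> R -> R).
Hypotheses (fs : full_support mu) (prop : proper_metric X).
Hypotheses (dH_gt0 : 0 < dH) (ahlfors : ahlfors_regular mu dH).
Hypotheses (dW_gt1 : 1 < dW) (delta01 : 0 < delta < 1).
Hypothesis eta_density : subordinator_density delta eta.
Hypothesis p_continuous : forall t : R, 0 < t -> continuous (fun z : X * X => p t z.1 z.2).
Hypothesis HK : sub_gaussian_bounds mu p dH dW.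

Let K := subordinated_kernel eta p.
Let dW_gt0 : 0 < dW. Proof. exact: lt_trans dW_gt1. Qed.

Let p_ge0 t x y : 0 < t -> 0 <= p t x y.
Proof.
move=> t0; have [c3 [c4 [c5 [c6 [_ _ c50 _ H]]]]] :=
  sub_gaussian_bounds_everywhere fs dW_gt1 p_continuous HK.
have /andP[+ _] := H t x y t0; apply: le_trans.
by rewrite !mulr_ge0 ?powR_ge0 ?expR_ge0// ltW.
Qed.

Let K_ge0 t x y : 0 < t -> (0 <= K t x y)%E.
Proof.
move=> t0; apply: integral_ge0 => s Is; rewrite lee_fin.
rewrite mulr_ge0 ?(density_ge0 eta_density)// p_ge0//.
by move: Is; rewrite /= in_itv/= andbT.
Qed.

Let besov_oscillation_le al f : besov_class mu K 1 al f ->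
  exists2 M, 0 <= M & forall t rho, 0 < t -> 0 < rho -> t <= rho `^ (delta * dW) ->
    (oscillation mu f rho <= (M * t `^ (al - 1) * rho `^ (dH + delta * dW))%:E)%E.
Proof.
have [c3 [c4 [c5 [c6 [_ _ c50 c60 H]]]]] :=
  sub_gaussian_bounds_everywhere fs dW_gt1 p_continuous HK.
have [|k k0 Kge] := subordinated_kernel_ge dH_gt0 dW_gt1 c50 c60 delta01 eta_density (p := p).
  by move=> t x y t0; have /andP[] := H t x y t0.
exact: besov_oscillation k0 K_ge0 Kge.
Qed.

(** The choice [t = r `^ (delta * dW)] in [besov_oscillation]. *)
Lemma besov_sub_korevaar_schoen al f :
  besov_class mu K 1 al f -> korevaar_schoen mu (al * (delta * dW)) 1 f.
Proof.
move=> fB; have [M M0 H] := besov_oscillation_le fB.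
have [c1 [c2 [c10 c20 vol]]] := ahlfors.
apply: (oscillation_korevaar_schoen prop c10 c20 vol (M := M) (r0 := 1)) => //.
  by case: fB.
move=> r r0 _; have rp : 0 < r `^ (delta * dW) by rewrite powR_gt0.
apply: le_trans (H _ r rp r0 (lexx _)) _; rewrite lee_fin -powRrM -mulrA.
rewrite ler_wpM2l// -powRD ?(gt_eqF r0) ?implybT//.
by rewrite le_eqVlt; apply/orP; left; apply/eqP; congr (_ `^ _); ring.
Qed.

(** At a fixed scale [rho], let [t] tend to [0] in [besov_oscillation]. *)
Lemma besov_gt1_constant al f : 1 < al -> besov_class mu K 1 al f -> ~ nonconstant mu f.
Proof.
move=> al1 fB; have [M M0 H] := besov_oscillation_le fB.
have mf : measurable_fun setT f by case: fB => /Lfun1_measurable.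
apply: oscillation0_constant => // rho rho0.
apply/eqP; rewrite eq_le oscillation_ge0 andbT; apply/lee_addgt0Pr => e e0.
rewrite add0e.
pose C := M * rho `^ (dH + delta * dW).
have C0 : 0 <= C by rewrite mulr_ge0 ?powR_ge0.
have C1 : 0 < C + 1 by lra.
have al0 : 0 < al - 1 by rewrite subr_gt0.
(* The second term makes [C * t `^ (al - 1)] smaller than [e]. *)
pose t := Num.min (rho `^ (delta * dW)) ((e / (C + 1)) `^ (al - 1)^-1).
have t0 : 0 < t by rewrite lt_min !powR_gt0// divr_gt0.
have tr : t <= rho `^ (delta * dW) by rewrite ge_min lexx.
apply: (le_trans (H t rho t0 rho0 tr)).
have te : t `^ (al - 1) <= e / (C + 1).
  have h : t <= (e / (C + 1)) `^ (al - 1)^-1 by rewrite ge_min lexx orbT.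
  apply: (@le_trans _ _ (((e / (C + 1)) `^ (al - 1)^-1) `^ (al - 1))).
    by apply: (ge0_ler_powR (ltW al0)) => //; rewrite nnegrE ?powR_ge0// ltW.
  by rewrite -powRrM mulVf ?gt_eqF// powRr1// divr_ge0// ltW.
rewrite lee_fin mulrAC -/C; apply: (@le_trans _ _ (C * (e / (C + 1)))).
  exact: ler_wpM2l.
by rewrite mulrA ler_pdivrMr// mulrC ler_pM2l//; lra.
Qed.

(** The upper bound on the kernel with exponent [th = al] makes the factor
    [t `^ (- al)] of the seminorm cancel for every [t], and leaves the fractional
    energy of exponent [al * (delta * dW) < lam]. *)
Lemma korevaar_schoen_sub_besov lam al f : 0 < al -> al < 1 ->
  al * (delta * dW) < lam -> korevaar_schoen mu lam 1 f -> besov_class mu K 1 al f.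
Proof.
move=> al0 al1 allam fKS; have [delta0 _] := andP delta01.
have fL : f \in Lfun mu 1 by case: fKS.
have mf := Lfun1_measurable fL.
have fi : mu.-integrable setT (EFin \o f) by exact/Lfun1_integrable.
have [c1 [c2 [c10 c20 vol]]] := ahlfors.
have [M [r0 [M0 r00 Hn]]] := korevaar_schoen_oscillation prop c10 c20 vol fKS.
have [c3 [c4 [c5 [c6 [c30 c40 _ _ H]]]]] :=
  sub_gaussian_bounds_everywhere fs dW_gt1 p_continuous HK.
have [|C C0 Kle] := subordinated_kernel_le dH_gt0 dW_gt1 c30 c40 eta_density (p := p).
  by move=> t x y t0; rewrite p_ge0//; have /andP[] := H t x y t0.
apply: (oscillation_besov prop (C := C) (q := dH + al * delta * dW)) => //.
- exact: ltW.
- by move=> t x y t0; apply: Kle => //; rewrite !ltW.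
have /lty_EFin_ub[N N0 HN] : (\int[mu]_x `|f x|%:E < +oo)%E by case/integrableP: fi.
apply: (fractional_energy_lty prop (lam := lam) (M := M) (A := 2 * c2 * N) (r0 := r0)) => //.
- by rewrite !mulr_ge0// ltW.
- by rewrite !mulr_gt0.
- by rewrite -mulrA.
move=> r rp.
have B0 : 0 <= c2 * r `^ dH by rewrite mulr_ge0 ?powR_ge0// ltW.
have volr x : (mu (ball x r) <= (c2 * r `^ dH)%:E)%E by have /andP[] := vol x r (ltW rp).
apply: (le_trans (oscillation_le_norm prop fi volr B0)).
apply: (@le_trans _ _ ((c2 * r `^ dH)%:E * N%:E + (c2 * r `^ dH)%:E * N%:E)%E).
  by apply: leeD; apply: lee_wpmul2l => //; rewrite lee_fin.
by rewrite -EFinM -EFinD lee_fin le_eqVlt; apply/orP; left; apply/eqP; ring.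
Qed.

End besov_exponent_bounds.

Theorem theorem4p1 (R : realType) (d : measure_display)
    (X : borelMetricType R d) (mu : {sigma_finite_measure set X -> \bar R})
    (F : set (X -> R)) (E : (X -> R) -> (X -> R) -> R)
    (P : R -> (X -> R) -> X -> R) (p : R -> X -> X -> R)
    (dH dW kappa delta : R) (eta : R -> R -> R)
    (X_lc : locally_compact [set: X])
    (mu_radon : radon_measure mu) (mu_supp : full_support mu)
    (E_dirichlet : dirichlet_form mu F E) (P_heat : heat_semigroup mu F E P)
    (A1 : proper_metric X)
    (dH_gt0 : 0 < dH) (A2 : ahlfors_regular mu dH)
    (A3_regular : regular_form mu F E) (A3_local : strongly_local mu F E)
    (dW_ge2 : 2 <= dW) (p_kernel : continuous_heat_kernel mu P p)
    (HK : sub_gaussian_bounds mu p dH dW)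
    (kappa_gt0 : 0 < kappa) (kappa_lt_dW : kappa < dW)
    (kappaE : (dW - kappa)%:E = korevaar_schoen_exponent mu 1)
    (BE : weak_bakry_emery mu p kappa dW)
    (delta_gt0 : 0 < delta) (delta_lt1 : delta < 1)
    (eta_density : subordinator_density delta eta) :
  let alpha1 := besov_exponent mu (subordinated_kernel eta p) 1 in
  (delta <= 1 - kappa / dW -> alpha1 = 1%:E) /\
  (1 - kappa / dW < delta -> alpha1 = (delta^-1 * (1 - kappa / dW))%:E).
Proof.
move=> alpha1.
have dW1 : 1 < dW by apply: lt_le_trans dW_ge2; rewrite ltr1n.
have dW0 : 0 < dW by exact: lt_trans dW1.
have d01 : 0 < delta < 1 by rewrite delta_gt0.
have p_cont t : 0 < t -> continuous (fun z : X * X => p t z.1 z.2).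
  by move=> t0; case: (p_kernel t t0).
pose B := delta^-1 * (1 - kappa / dW).
have BE' : B * (delta * dW) = dW - kappa by rewrite /B; field; lra.
have dWp : 0 < delta * dW by rewrite mulr_gt0.
have B0 : 0 < B by rewrite -(@pmulr_lgt0 _ (delta * dW))// BE' subr_gt0.
have le_1 : (alpha1 <= 1%:E)%E.
  apply: ge_ereal_sup => _ [al [al0 [f fB fnc]] <-].
  rewrite lee_fin leNgt; apply/negP => al1.
  exact: (besov_gt1_constant mu_supp A1 dH_gt0 dW1 d01 eta_density p_cont HK al1 fB fnc).
have le_B : (alpha1 <= B%:E)%E.
  apply: ge_ereal_sup => _ [al [al0 [f fB fnc]] <-].
  rewrite lee_fin -(ler_pM2r dWp) BE' -lee_fin kappaE.
  apply: ereal_sup_ubound; exists (al * (delta * dW)) => //.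
  split; first by rewrite mulr_gt0.
  exists f => //.
  exact: (besov_sub_korevaar_schoen mu_supp A1 dH_gt0 A2 dW1 d01 eta_density p_cont HK fB).
have ge_m C : 0 < C -> C <= 1 -> C <= B -> (C%:E <= alpha1)%E.
  move=> C0 C1 CB; apply: ereal_sup_ge_interval => // al al0 alC; split => //.
  have : ((al * (delta * dW))%:E < korevaar_schoen_exponent mu 1)%E.
    by rewrite -kappaE lte_fin -BE' ltr_pM2r// (lt_le_trans alC).
  move=> /ereal_sup_gt[_ [lam [lam0 [f fKS fnc]] <-]]; rewrite lte_fin => allam.
  exists f => //; have al1 := lt_le_trans alC C1.
  exact: (korevaar_schoen_sub_besov mu_supp A1 dH_gt0 A2 dW1 d01 eta_density p_cont HK
            al0 al1 allam fKS).
split => [dk|dk]; apply/eqP; rewrite eq_le ?le_1 ?le_B /=; apply: ge_m => //.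
- by rewrite /B ler_pdivlMl// mulr1.
- by rewrite ler_pdivrMl// mulr1 ltW.
Qed.
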